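(* For every $\Delta\in\mathbb N$ there exist positive constants $K$ and $C$ such that the following holds for every sufficiently large $d\in\mathbb N$. If $G$ is an $(n,d,\lambda)$-graph with $d/\lambda\ge C$, then $G$ contains a copy of every $n$-vertex tree with maximum degree at most $\Delta$ and at least $\frac{K\lambda n}{d}$ leaves.
   Context: An $(n,d,\lambda)$-graph is an $n$-vertex $d$-regular graph such that every eigenvalue of its adjacency matrix other than the largest one (which equals $d$) has absolute value at most $\lambda$. ''Sufficiently large $d$'' means: there exists $d_0=d_0(\Delta)$ such that the statement holds for all $d\ge d_0$ (with $K,C$ fixed). *)

(* Defs.v *)
From HB Require Import structures.
From mathcomp Require Import all_boot all_order all_algebra.
From mathcomp Require Import complex reals.

Set Implicit Arguments.
Unset Strict Implicit.
Unset Printing Implicit Defensive.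

Import Order.TTheory GRing.Theory Num.Theory.
Local Open Scope ring_scope.

Record sgraph := SGraph {
  vertex :> finType;
  adj : rel vertex;
  adj_sym : symmetric adj;
  adj_irr : irreflexive adj }.

Definition deg (G : sgraph) (x : G) : nat := #|[set y | adj x y]|.

Definition max_deg (G : sgraph) : nat := (\max_(x : G) deg x)%N.

Definition regular (G : sgraph) (d : nat) : Prop := forall x : G, deg x = d.

Definition leaves (G : sgraph) : {set G} := [set x : G | deg x == 1%N].

Definition connected_graph (G : sgraph) : Prop :=
  (0 < #|G|)%N /\ forall x y : G, connect (@adj G) x y.

(* Since [adj] is symmetric, an edge traversed back and forth is a [ucycle] of
   size 2; graph cycles are the [ucycle]s of size at least 3. *)
Definition acyclic (G : sgraph) : Prop :=
  forall c : seq G, ucycle (@adj G) c -> (size c < 3)%N.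

Definition is_tree (G : sgraph) : Prop := connected_graph G /\ acyclic G.

(* [G] contains a copy of [H] as a (not necessarily induced) subgraph. *)
Definition contains_copy (G H : sgraph) : Prop :=
  exists f : H -> G, injective f /\ forall x y : H, adj x y -> adj (f x) (f y).

Definition adj_mx (R : realType) (G : sgraph) : 'M[R]_#|G| :=
  \matrix_(i, j) (adj (enum_val i) (enum_val j))%:R.

(* [s] lists the eigenvalues of [A] with multiplicity, in nonincreasing
   order. *)
Definition is_spectrum (R : realType) (n : nat) (A : 'M[R]_n) (s : seq R) :
    Prop :=
  sorted >=%R s /\ char_poly A = \prod_(x <- s) ('X - x%:P).

(* Every symmetric real matrix, in particular every adjacency matrix, has such
   a list, so the existential in [ndl_graph] is not a restriction. *)
Lemma spectrum_exists (R : realType) (n : nat) (A : 'M[R]_n) :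
  A^T = A -> exists s : seq R, is_spectrum A s.
Proof.
move=> Asym; pose f : {rmorphism R -> R[i]} := real_complex R.
pose B := map_mx f A.
have Bherm : B \is hermsymmx.
  apply: realsym_hermsym.
    by apply/is_hermitianmxP; rewrite expr0 scale1r map_mx_id // /B map_trmx Asym.
  by apply/mxOverP => i j; rewrite mxE; apply/complex_realP; exists (A i j).
have spR := hermitian_spectral_diag_real Bherm.
have /orthomx_spectralP BE := hermitian_normalmx Bherm.
pose P := map_mx polyC (spectralmx B).
have PP : map_mx polyC (invmx (spectralmx B)) *m P = 1%:M.
  by rewrite -map_mxM mulVmx ?spectral_unit // map_mx1.
pose s := [seq complex.Re (spectral_diag B 0 i) | i <- enum 'I_n].
exists (sort >=%R s); split.
  by apply: sort_sorted => x y; exact: le_total.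
rewrite (perm_big s) /=; last by rewrite perm_sort.
apply: (map_poly_inj f); rewrite rmorph_prod /= map_char_poly -/B.
have -> : char_poly B = char_poly (diag_mx (spectral_diag B)).
  have -> : char_poly B = \det (map_mx polyC (invmx (spectralmx B)) *m
      char_poly_mx (diag_mx (spectral_diag B)) *m P).
    rewrite /char_poly {1}BE /char_poly_mx mulmxBr mulmxBl !map_mxM /=.
    by rewrite -/P scalar_mxC -(mulmxA 'X%:M) PP mulmx1.
  by rewrite !det_mulmx mulrAC -det_mulmx PP det1 mul1r.
rewrite char_poly_trig ?diag_mx_is_trig // big_map big_enum /=.
apply: eq_bigr => i _; rewrite rmorphB /= map_polyX map_polyC /=.
rewrite mxE eqxx mulr1n; congr ('X - _%:P).
by have /mxOverP/(_ 0 i)/complex_realP[x ->] := spR.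
Qed.

(* An (n, d, lam)-graph. Eigenvalues are counted with multiplicity, so exactly
   one occurrence of the largest one is exempt from the bound: a disconnected
   d-regular graph has [d] as second eigenvalue. *)
Definition ndl_graph (R : realType) (n d : nat) (lam : R) (G : sgraph) : Prop :=
  [/\ #|G| = n, regular G d &
      exists s : seq R, is_spectrum (adj_mx R G) s /\
        forall mu, mu \in behead s -> `|mu| <= lam].

(* Main.v *)
Require Import Defs.
From mathcomp Require Import all_boot all_order all_algebra complex reals.
From mathcomp Require boolp.
From mathcomp Require Import zify ring lra.

Set Implicit Arguments.
Unset Strict Implicit.
Unset Printing Implicit Defensive.

(* Put m = floor(lam n / d) + 1. By the spectral gap any two sets of m vertices
   are joined by an edge and sets of at most 2m vertices expand by a large
   factor D, so the Friedman-Pippenger technique embeds trees vertex by vertex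
   while all small sets keep many unused neighbours.

   Choose for every parent of a leaf one leaf, delete the chosen leaves, embed
   the remaining tree T', and put the deleted leaves back by a perfect matching
   between the unused vertices and the images of the parents. In Hall's
   condition the large sets are handled by the expansion into unused vertices,
   and the middle ones by the edges between m-sets. For the small ones a set Q
   of at most 4m vertices is reserved in advance such that every set of at most
   m vertices has as many neighbours in Q, and T' is embedded so that every
   vertex of Q is the image of a parent.

   Covering Q exactly is the heart of the proof. T is cut by single edges into
   blocks with geometrically decreasing numbers of parents. In the k-th block
   parents z whose ancestor paths of length 2k+1 are disjoint are selected, and
   when the path of z is embedded one tries to end it at an uncovered vertex of
   Q. Growing b-ary forests of depth k from the images where this failed and
   from the uncovered vertices shows that at most m / b^k vertices of Q stay
   uncovered after the k-th block. There are enough disjoint paths in each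
   block because b exceeds a fixed power of the maximum degree. *)

(** * Embedding into expanders *)

Definition upd (T : eqType) (U : Type) (f : T -> U) (t : T) (u : U) : T -> U :=
  fun s => if s == t then u else f s.

Lemma card_bigcup_sum (I T : finType) (A : {pred I}) (F : I -> {set T}) :
  #|\bigcup_(i in A) F i| <= \sum_(i in A) #|F i|.
Proof.
elim/big_rec2: _ => [|i s S _ IH]; first by rewrite cards0.
by apply: leq_trans (leq_card_setU _ _) _; rewrite leq_add2l.
Qed.

Lemma card_bigcup_le (I T : finType) (A : {pred I}) (F : I -> {set T}) k :
  (forall i, i \in A -> #|F i| <= k) -> #|\bigcup_(i in A) F i| <= #|A| * k.
Proof.
move=> hk; apply: leq_trans (card_bigcup_sum _ _) _.
by rewrite -sum_nat_const; apply: leq_sum.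
Qed.

(** * Extending a partial embedding one vertex at a time *)

Section FriedmanPippenger.
Variables (V : finType) (e : rel V) (A : {set V}) (D m cap : nat).
Implicit Types (X Y H : {set V}) (p : V -> V).

Definition nbr X := [set w | [exists x in X, e x w]].

(** [H] holds the used vertices and [p w] the vertex to which a used [w] is attached. Counting both
    the free neighbours of [X] and those already attached to [X] lets one bound [D] pay for past and
    future children alike. *)
Definition rnbr H p X :=
  [set w | [exists x in X, e x w && ((w \in H) ==> (p w == x))]].

Definition ext H p : bool :=
  [forall w in H, e (p w) w] &&
  [forall X : {set V}, (X \subset A) ==> (#|X| <= m.*2) ==>
     (D * #|X| <= #|rnbr H p X|)].

Definition outdeg H p v := #|[set w in H | p w == v]|.

Lemma extP H p :
  reflect ((forall w, w \in H -> e (p w) w) /\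
           (forall X, X \subset A -> #|X| <= m.*2 -> D * #|X| <= #|rnbr H p X|))
          (ext H p).
Proof.
apply: (iffP andP) => -[].
  move=> /forallP h1 /forallP h2; split=> [w wH|X sX cX].
    by have /implyP := h1 w; apply.
  by have /implyP/(_ sX)/implyP := h2 X; apply.
move=> h1 h2; split.
  by apply/forallP => w; apply/implyP; exact: h1.
by apply/forallP => X; apply/implyP => sX; apply/implyP => cX; apply: h2.
Qed.

Lemma nbrP X w : reflect (exists2 x, x \in X & e x w) (w \in nbr X).
Proof.
rewrite inE; apply: (iffP existsP) => -[x].
  by case/andP; exists x.
by move=> xX exw; exists x; rewrite xX.
Qed.

Lemma rnbrP H p X w :
  reflect (exists x, [/\ x \in X, e x w & w \in H -> p w = x]) (w \in rnbr H p X).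
Proof.
rewrite inE; apply: (iffP existsP) => -[x].
  by case/and3P=> xX exw /implyP h; exists x; split=> // /h/eqP.
case=> xX exw h; exists x; rewrite xX exw /=.
by apply/implyP => /h ->.
Qed.

Lemma nbrD_sub_rnbr H p X : nbr X :\: H \subset rnbr H p X.
Proof.
apply/subsetP => w; rewrite in_setD => /andP[wH /nbrP[x xX exw]].
by apply/rnbrP; exists x; split=> //; rewrite (negbTE wH).
Qed.

Lemma nbrU X Y : nbr (X :|: Y) = nbr X :|: nbr Y.
Proof.
apply/setP => w; rewrite in_setU; apply/nbrP/orP.
  by case=> x; rewrite in_setU => /orP[]; [left|right]; apply/nbrP; exists x.
by case=> /nbrP[x xX exw]; exists x; rewrite // in_setU xX ?orbT.
Qed.

Lemma rnbrU H p X Y : rnbr H p (X :|: Y) = rnbr H p X :|: rnbr H p Y.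
Proof.
apply/setP => w; rewrite in_setU; apply/rnbrP/orP.
  case=> x [+ exw h].
  by rewrite in_setU => /orP[] xX; [left|right]; apply/rnbrP; exists x.
by case=> /rnbrP[x [xX exw h]]; exists x; rewrite in_setU xX ?orbT.
Qed.

Lemma rnbr_mono H p X Y : X \subset Y -> rnbr H p X \subset rnbr H p Y.
Proof.
move=> sXY; apply/subsetP => w /rnbrP[x [xX exw h]].
by apply/rnbrP; exists x; split=> //; apply: (subsetP sXY).
Qed.

(** Forgetting used vertices only frees them, so auxiliary trees may be grown for a search and then
    discarded. *)
Lemma ext_rollback H H' p p' : H' \subset H -> {in H', p =1 p'} ->
  ext H p -> ext H' p'.
Proof.
move=> /subsetP sH epp /extP[h1 h2]; apply/extP; split=> [w wH|X sX cX].
  by rewrite -epp //; apply/h1/sH.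
apply: leq_trans (h2 X sX cX) _; apply/subset_leq_card/subsetP => w.
case/rnbrP=> x [xX exw h]; apply/rnbrP; exists x; split=> // wH'.
by rewrite -epp //; apply/h/sH.
Qed.

Lemma rnbr_card_nbr H p X : #|nbr X| <= #|rnbr H p X| + #|H|.
Proof.
have := subset_leq_card (nbrD_sub_rnbr H p X).
by have := cardsID H (nbr X); have := subset_leq_card (subsetIr (nbr X) H); lia.
Qed.

Lemma rnbr_outdeg H p X b : (forall x, x \in X -> outdeg H p x <= b) ->
  #|rnbr H p X| <= #|nbr X :\: H| + b * #|X|.
Proof.
move=> hb.
have sub : rnbr H p X \subset
    (nbr X :\: H) :|: \bigcup_(x in X) [set w in H | p w == x].
  apply/subsetP => w /rnbrP[x [xX exw h]]; rewrite in_setU in_setD.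
  case: (boolP (w \in H)) => wH /=; last first.
    by apply/orP; left; apply/nbrP; exists x.
  by apply/bigcupP; exists x; rewrite // inE wH /= h.
apply: leq_trans (subset_leq_card sub) _.
apply: leq_trans (leq_card_setU _ _) _; rewrite leq_add2l.
by rewrite mulnC; apply: card_bigcup_le.
Qed.

Lemma outdegU1 H p w x v : w \notin H ->
  outdeg (w |: H) (upd p w x) v = outdeg H p v + (x == v).
Proof.
move=> wH; rewrite /outdeg.
have E : [set u in H | upd p w x u == v] = [set u in H | p u == v].
  apply/setP => u; rewrite !inE /upd; case: (u =P w) => // ->.
  by rewrite (negbTE wH).
rewrite -E; case: eqP => [<-|/eqP ne].
  have -> : [set u in w |: H | upd p w x u == x] =
            w |: [set u in H | upd p w x u == x].
    apply/setP => u; rewrite !inE.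
    by case: (u =P w) => //= ->; rewrite /upd eqxx eqxx.
  by rewrite cardsU1 inE (negbTE wH) /= addnC.
rewrite addn0; congr #|pred_of_set _|; apply/setP => u; rewrite !inE.
by case: (u =P w) => //= ->; rewrite /upd eqxx (negbTE ne) (negbTE wH).
Qed.

Hypothesis m_gt0 : 0 < m.
Hypothesis joined : forall X, X \subset A -> m <= #|X| -> #|X| <= m.*2 ->
  D * #|X| + cap < #|nbr X|.

(* The sets violating the expansion after adding [w] as a child of [x] are
   tight; tight sets are closed under union because the size of [rnbr] is
   submodular and large sets are never tight, so a maximal tight set absorbs
   every candidate [w]. *)
Lemma fp_step H p x : ext H p -> #|H| <= cap -> x \in A -> outdeg H p x < D ->
  exists w, [/\ e x w, w \notin H & ext (w |: H) (upd p w x)].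
Proof.
move=> Hext capH xA odx; have /extP[h1 h2] := Hext.
case: (pickP (fun w => [&& e x w, w \notin H & ext (w |: H) (upd p w x)])).
  by move=> w /and3P[? ? ?]; exists w.
move=> none; exfalso.
pose crit (X : {set V}) :=
  [&& X \subset A, #|X| <= m.*2, #|rnbr H p X| <= D * #|X| & x \notin X].
have crit0 : crit set0.
  rewrite /crit sub0set cards0 in_set0 muln0 /= andbT leqn0 cards_eq0.
  by apply/eqP/setP => w; rewrite in_set0; apply/rnbrP => -[y []]; rewrite in_set0.
have critlt X : crit X -> #|X| < m.
  case/and4P => sX cX tX _; rewrite ltnNge; apply/negP => mX.
  by have := joined sX mX cX; have := rnbr_card_nbr H p X; lia.
have critU X Y : crit X -> crit Y -> crit (X :|: Y).
  move=> cX cY; have ltX := critlt _ cX; have ltY := critlt _ cY.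
  case/and4P: cX => sX cX tX xX; case/and4P: cY => sY cY tY xY.
  have cUI := cardsUI X Y.
  apply/and4P; split.
  - by rewrite subUset sX.
  - by lia.
  - have hI : D * #|X :&: Y| <= #|rnbr H p (X :&: Y)|.
      apply: h2; first exact: subset_trans (subsetIl _ _) sX.
      by have := subset_leq_card (subsetIl X Y); lia.
    have cR := cardsUI (rnbr H p X) (rnbr H p Y).
    have : rnbr H p (X :&: Y) \subset rnbr H p X :&: rnbr H p Y.
      by rewrite subsetI !rnbr_mono ?subsetIl ?subsetIr.
    move/subset_leq_card; rewrite rnbrU.
    have : D * #|X :|: Y| + D * #|X :&: Y| = D * #|X| + D * #|Y|.
      by rewrite -!mulnDr cUI.
    lia.
  - by rewrite in_setU negb_or xX.
case: (arg_maxnP (fun X : {set V} => #|X|) crit0) => Z critZ Zmax.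
have cover w : e x w -> w \notin H -> w \in rnbr H p Z.
  move=> exw wH; have := none w; rewrite exw wH /= => /negbT.
  rewrite /ext negb_and => /orP[].
    case/forallPn=> u; rewrite negb_imply => /andP[]; rewrite in_setU1 /upd.
    by case: eqP => [->|_] /=; rewrite ?exw // => /h1 ->.
  case/forallPn=> X; rewrite !negb_imply -ltnNge => /and3P[sX cX bX].
  have sub : rnbr H p X :\ w \subset rnbr (w |: H) (upd p w x) X.
    apply/subsetP => u; rewrite in_setD1 => /andP[uw /rnbrP[y [yX eyu h]]].
    apply/rnbrP; exists y; split=> //; rewrite in_setU1 (negbTE uw) /= => uH.
    by rewrite /upd (negbTE uw); exact: h.
  have c1 := subset_leq_card sub; have c2 := h2 X sX cX.
  have c3 := cardsD1 w (rnbr H p X).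
  have wX : w \in rnbr H p X.
    by case: (w \in _) c3 => //=; lia.
  (* If [x] lay in [X], then [w], as a child of [x], would still be counted and the bound would not
     drop. *)
  have xX : x \notin X.
    apply/negP => xX.
    have : rnbr H p X \subset rnbr (w |: H) (upd p w x) X.
      apply/subsetP => u /rnbrP[y [yX eyu h]]; case: (u =P w) => [->|/eqP uw].
        by apply/rnbrP; exists x; split=> //; rewrite /upd eqxx.
      apply/rnbrP; exists y; split=> //; rewrite in_setU1 (negbTE uw) /= => uH.
      by rewrite /upd (negbTE uw); exact: h.
    by move/subset_leq_card; move: bX c2; clear; lia.
  have critX : crit X by apply/and4P; split=> //; rewrite wX in c3; move: c1 c3 bX; clear; lia.
  have := Zmax _ (critU _ _ critX critZ) => le.
  have /eqP XZ : Z == X :|: Z by rewrite eqEcard subsetUr.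
  by rewrite XZ rnbrU in_setU wX.
(* Adding [x] to [Z] contributes only the present children of [x], fewer than [D], so [x |: Z]
   violates the invariant for [H] and [p]. *)
have ltZ := critlt _ critZ; case/and4P: critZ => sZ cZ tZ xZ.
have := h2 (x |: Z); rewrite subUset sub1set xA sZ cardsU1 xZ => /(_ isT).
have -> : 1 + #|Z| <= m.*2 by lia.
move=> /(_ isT).
have : rnbr H p (x |: Z) \subset rnbr H p Z :|: [set w in H | p w == x].
  apply/subsetP => w; rewrite rnbrU !in_setU => /orP[|->//].
  case/rnbrP=> y [/set1P -> exw h]; rewrite inE.
  case: (boolP (w \in H)) => [wH|wH]; first by rewrite (h wH) eqxx orbT.
  by rewrite cover.
move/subset_leq_card/leq_trans => /(_ _ (leq_card_setU _ _)).
by rewrite -/(outdeg H p x); move: odx tZ; rewrite mulnDr muln1; lia.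
Qed.

(** Iterates [fp_step]; an element repeated in [xs] receives that many children. The bound is
    [cap.+1] because only the set before each step has to stay within [cap]. *)
Lemma fp_multi xs H p : ext H p -> #|H| + size xs <= cap.+1 ->
  (forall x, x \in xs -> x \in A) ->
  (forall x, x \in xs -> outdeg H p x + count_mem x xs <= D) ->
  exists ws p', [/\ size ws = size xs, uniq ws /\ (forall w, w \in ws -> w \notin H),
    {in H, p' =1 p} /\ ext (H :|: [set w in ws]) p',
    (forall i w0, i < size xs -> p' (nth w0 ws i) = nth w0 xs i) &
    forall v, outdeg (H :|: [set w in ws]) p' v = outdeg H p v + count_mem v xs].
Proof.
elim: xs H p => [|x xs IH] H p Hext capH xsA od.
  exists [::], p.
  have E : H :|: [set w in [::]] = H.
    by apply/setP => w; rewrite !inE orbF.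
  by rewrite E; split=> // v; rewrite addn0.
have [||w [exw wH wext]] := fp_step Hext _ (xsA x (mem_head _ _)).
- by move: capH => /=; lia.
- by have := od x (mem_head _ _); rewrite /= eqxx; lia.
have [||y yxs|ws [p' [sws [uws dws] [epp pext] pnth pod]]] :=
    IH (w |: H) (upd p w x) wext.
- by move: capH; rewrite cardsU1 wH /=; lia.
- by move=> y yxs; apply: xsA; rewrite in_cons yxs orbT.
- rewrite outdegU1 //; have := od y; rewrite in_cons yxs orbT => /(_ isT) /=.
  by lia.
have E : H :|: [set u in w :: ws] = w |: H :|: [set u in ws].
  by apply/setP => u; rewrite !inE orbCA orbA.
exists (w :: ws), p'; rewrite E; split=> //=.
- by rewrite sws.
- split.
    rewrite uws andbT; apply/negP => /dws; by rewrite setU11.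
  move=> u; rewrite in_cons => /orP[/eqP ->//|/dws].
  by rewrite in_setU1 negb_or => /andP[].
- split=> // u uH; rewrite epp ?in_setU1 ?uH ?orbT //.
  by rewrite /upd; case: eqP => // uw; rewrite -uw uH in wH.
- case=> [|i] w0 /=; last by move=> lt; apply: pnth.
  by rewrite epp ?setU11 // /upd eqxx.
- by move=> v; rewrite pod outdegU1 // addnA.
Qed.

End FriedmanPippenger.

Lemma ext0 (V : finType) (e : rel V) (A : {set V}) (D m : nat) (p : V -> V) :
  (forall X : {set V}, X \subset A -> #|X| <= m.*2 -> D * #|X| <= #|nbr e X|) ->
  ext e A D m set0 p.
Proof.
move=> h; apply/extP; split=> [w|X sX cX]; first by rewrite in_set0.
apply: leq_trans (h X sX cX) _; apply/subset_leq_card.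
by apply: subset_trans (nbrD_sub_rnbr e set0 p X); rewrite setD0.
Qed.

Lemma outdeg0 (V : finType) (p : V -> V) v : outdeg set0 p v = 0.
Proof. by apply/eqP; rewrite cards_eq0; apply/eqP/setP => w; rewrite !inE. Qed.

(** Friedman-Pippenger with [D = 1] and one child for each element of [U]. As [m] exceeds the number
    of vertices, the hypothesis on large sets is vacuous. *)
Lemma hall (V : finType) (e : rel V) (U : {set V}) :
  (forall X : {set V}, X \subset U -> #|X| <= #|nbr e X|) ->
  exists f : V -> V, {in U &, injective f} /\ {in U, forall u, e u (f u)}.
Proof.
move=> hall.
have xext : ext e U 1 #|V|.+1 set0 id.
  by apply: ext0 => X sX _; rewrite mul1n hall.
have [|||||ws [p' [sws [uws _] [_ pext] pnth _]]] :=
  @fp_multi V e U 1 #|V|.+1 #|V| _ _ (enum U) set0 id xext.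
- by [].
- by move=> X _ lt; have := leq_trans lt (max_card _); rewrite ltnn.
- by rewrite cards0 -cardE add0n ltnW // ltnS max_card.
- by move=> x; rewrite mem_enum.
- move=> x; rewrite mem_enum => xU.
  by rewrite outdeg0 count_uniq_mem ?enum_uniq // mem_enum xU.
exists (fun u => nth u ws (index u (enum U))).
have lt u : u \in U -> index u (enum U) < size ws.
  by rewrite sws index_mem mem_enum.
split=> [u v uU vU|u uU].
  rewrite (set_nth_default u v) ?lt // => /eqP.
  rewrite nth_uniq ?lt // => /eqP E.
  by rewrite -(nth_index u (_ : u \in enum U)) ?E ?nth_index ?mem_enum.
have := pnth (index u (enum U)) u; rewrite -sws => /(_ (lt u uU)).
rewrite nth_index ?mem_enum // => {1}<-.
have /extP[h1 _] := pext; apply: h1.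
by rewrite set0U inE mem_nth ?lt.
Qed.

(** * Growing forests and linking two sets by a path *)

Section Linking.
Variables (V : finType) (e : rel V) (D m cap b : nat).
Hypothesis e_sym : symmetric e.
Hypothesis m_gt0 : 0 < m.
Hypothesis b_gt1 : 1 < b.
Hypothesis joinedJ : forall X : {set V}, m <= #|X| -> #|~: nbr e X| < m.
Hypothesis cap_le : cap + m + m.*2 * D <= #|V|.
Implicit Types (X H L Q : {set V}) (p : V -> V).

Notation ext := (ext e setT D m).

Lemma joined_cap X : X \subset setT -> m <= #|X| -> #|X| <= m.*2 ->
  D * #|X| + cap < #|nbr e X|.
Proof.
move=> _ mX Xm; have := joinedJ mX; have := cardsC (nbr e X).
have : D * #|X| <= m.*2 * D by rewrite mulnC leq_mul2r Xm orbT.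
by move: cap_le; clear; lia.
Qed.

Definition chain p H L x s w :=
  [&& path (fun a c => p c == a) x s, last x s == w, uniq s &
      all (fun v => v \in L :\: H) s].

(** All leaves receive [b] children at once, [k] times, which gives disjoint [b]-ary trees rooted in
    [X] with leaf set [L]; the factor 2 bounds the geometric sum. The out-degree clause allows a
    second forest to be grown next to the first. *)
Lemma grow k H p X : ext H p -> X \subset H ->
  (forall v, (v \in X) || (v \notin H) -> outdeg H p v + b <= D) ->
  #|H| + 2 * (b ^ k * #|X|) <= cap ->
  exists H' p' L,
    [/\ H \subset H' /\ {in H, p' =1 p}, ext H' p',
        #|H'| <= #|H| + 2 * (b ^ k * #|X|) /\ #|L| = b ^ k * #|X|,
        forall v, (v \notin X) && (v \notin H' :\: H) || (v \in L) ->
          outdeg H' p' v <= outdeg H p v &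
        forall w, w \in L -> exists x s,
          [/\ x \in X, size s = k & chain p' H H' x s w]] /\
    (L \subset H' /\ (forall v, v \in L -> (v \in X) || (v \notin H))).
Proof.
move=> Hext sXH od.
elim: k => [|k IH] capH.
  exists H, p, X; split; last by split=> // v ->.
  split=> //; first by rewrite expn0 mul1n; split=> //; lia.
  by move=> w wX; exists w, [::]; split=> //; rewrite /chain /= eqxx.
have bk : b ^ k * #|X| * 2 <= b ^ k.+1 * #|X|.
  by rewrite expnS mulnC mulnA leq_mul2r leq_mul2r b_gt1 !orbT.
have [|H1 [p1 [L [[[sH epp] ext1 [cH1 cL] od1 ch1] [sL LX]]]]] := IH; first by lia.
pose xs := flatten (nseq b (enum L)).
have cnt v : count_mem v xs = b * (v \in L).
  rewrite /xs; elim: (b) => [|c IHc] //=.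
  by rewrite count_cat IHc count_uniq_mem ?enum_uniq // mem_enum mulSn.
have szxs : size xs = b * #|L|.
  rewrite /xs; elim: (b) => [|c IHc] //=.
  by rewrite size_cat IHc mulSn -cardE.
have memxs v : v \in xs -> v \in L.
  by rewrite -has_pred1 has_count cnt; case: (v \in L); rewrite ?muln0.
have [|||ws [p2 [sws [uws dws] [epp2 ext2] nth2 od2]]] :=
    @fp_multi V e setT D m cap m_gt0 joined_cap xs H1 p1 ext1.
- by rewrite szxs cL mulnA -expnS; lia.
- by move=> x _; rewrite inE.
- move=> x xxs; rewrite cnt (memxs x xxs) muln1.
  have := od1 x; rewrite (memxs x xxs) orbT => /(_ isT).
  by have := od x (LX x (memxs x xxs)); lia.
set H2 := H1 :|: [set w in ws].
have sH2 : H1 \subset H2 by exact: subsetUl.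
have cws : #|[set w in ws]| = b ^ k.+1 * #|X|.
  by rewrite cardsE (card_uniqP uws) sws szxs cL mulnA -expnS.
have dws' w : w \in ws -> w \notin H.
  by move/dws; apply: contra; exact: (subsetP sH).
exists H2, p2, [set w in ws]; split; last first.
  split; first exact: subsetUr.
  by move=> v; rewrite inE => /dws' ->; rewrite orbT.
split=> //.
- split; first exact: subset_trans sH2.
  by move=> v vH; rewrite epp2 ?epp //; exact: (subsetP sH).
- split=> //; apply: leq_trans (leq_card_setU _ _) _; rewrite cws; move: cH1 bk; clear; lia.
- move=> v hv; rewrite od2 cnt.
  have vL : v \notin L.
    apply/negP => vL; have vH1 := subsetP sL _ vL.
    case/orP: hv => [/andP[vX]|]; last by rewrite inE => /dws; rewrite vH1.
    rewrite in_setD (subsetP sH2 _ vH1) andbT => vH.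
    by have := LX _ vL; rewrite (negbTE vX) /= (negbTE vH).
  rewrite (negbTE vL) muln0 addn0; apply: od1; rewrite (negbTE vL) orbF.
  case/orP: hv => [/andP[-> ]|] /=.
    by apply: contra; rewrite !in_setD => /andP[-> /(subsetP sH2)].
  rewrite inE => vws; rewrite in_setD (negbTE (dws _ vws)) andbF andbT.
  by apply: contra (dws' _ vws); exact: (subsetP sXH).
- move=> w; rewrite inE => wws.
  have iw : index w ws < size xs by rewrite -sws index_mem.
  have pw : p2 w \in L.
    by rewrite -(nth_index w wws) nth2 // memxs // mem_nth.
  have [x [s [xX ss /and4P[ps /eqP ls us as_]]]] := ch1 _ pw.
  exists x, (rcons s w); split=> //; first by rewrite size_rcons ss.
  have sinH1 v : v \in s -> v \in H1.
    by move=> vs; have /allP/(_ v vs) := as_; rewrite inE => /andP[].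
  apply/and4P; split.
  - rewrite rcons_path ls eqxx andbT -(@eq_in_path _ (mem H1) (fun a c => p1 c == a)) //.
      by move=> a c _ cH; rewrite /= epp2.
    apply/allP => v; rewrite in_cons => /orP[/eqP ->|/sinH1 //].
    exact/(subsetP sH)/(subsetP sXH).
  - by rewrite last_rcons.
  - by rewrite rcons_uniq us andbT; apply/negP => /sinH1; rewrite (negbTE (dws _ wws)).
  - rewrite all_rcons in_setD dws' //= in_setU inE wws orbT /=.
    apply/allP => v vs; have /allP/(_ v vs) := as_.
    by rewrite !in_setD => /andP[-> /(subsetP sH2)].
Qed.

(** Inner vertices may be attached to either neighbour on the path, since [link] grows the two
    halves from opposite ends. *)
Definition linkable H p Q x k := exists vs p' q,
  [/\ [/\ size vs = k.*2, uniq vs & forall v, v \in vs -> v \notin H],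
      path e x (rcons vs q) /\ q \in Q,
      {in H, p' =1 p} /\ ext (H :|: [set v in vs]) p' &
      forall i, i < k.*2 -> p' (nth x (rcons vs q) i) = nth x (x :: rcons vs q) i \/
                            p' (nth x (rcons vs q) i) = nth x (rcons vs q) i.+1].

(** A link available late was available early, by rollback. Contrapositively, once linking from [x]
    fails it keeps failing. *)
Lemma linkable_mono H p Q H1 p1 Q1 x k : H \subset H1 -> {in H, p1 =1 p} ->
  Q1 \subset Q -> linkable H1 p1 Q1 x k -> linkable H p Q x k.
Proof.
move=> sH epp sQ [vs [p' [q [[svs uvs dvs] [pvs qQ] [epp' ext'] lk]]]].
exists vs, p', q; split=> //.
- by split=> // v /dvs; apply: contra; exact: (subsetP sH).
- by split=> //; exact: (subsetP sQ).
- split; first by move=> v vH; rewrite epp' ?epp //; exact: (subsetP sH).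
  by apply: ext_rollback ext' => //; exact: setSU.
Qed.

Lemma subset_of_card X t : t <= #|X| -> exists2 Y : {set V}, Y \subset X & #|Y| = t.
Proof.
move=> tX; exists [set x in take t (enum X)].
  by apply/subsetP => x; rewrite inE => /mem_take; rewrite mem_enum.
rewrite cardsE (card_uniqP _) ?take_uniq ?enum_uniq // size_take -cardE.
by case: ltnP => //; lia.
Qed.

(** Forests of depth [k] grown from [X] and from [Q] have more than [m] leaves each, so an edge
    joins the two leaf sets; everything except the two branches meeting there is rolled back. *)
Lemma link k H p X Q : ext H p -> X \subset H -> Q \subset H -> [disjoint X & Q] ->
  (forall v, outdeg H p v + b <= D) -> b ^ k <= b * m ->
  m < #|X| * b ^ k -> m < #|Q| * b ^ k -> #|H| + 4 * (b.+1 * m) <= cap ->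
  exists2 x, x \in X & linkable H p Q x k.
Proof.
move=> Hext sXH sQH dXQ od bkm mX mQ capH.
have bk0 : 0 < b ^ k by rewrite expn_gt0 ltnW.
(* The least number of roots giving more than [m] leaves; [b ^ k <= b * m] keeps the leaves to
   [b.+1 * m] and each forest to twice that. *)
pose t := (m %/ b ^ k).+1.
have [X1 sX1 cX1] : exists2 Y : {set V}, Y \subset X & #|Y| = t.
  by apply: subset_of_card; rewrite ltn_divLR.
have [Q1 sQ1 cQ1] : exists2 Y : {set V}, Y \subset Q & #|Y| = t.
  by apply: subset_of_card; rewrite ltn_divLR.
have bt : m < b ^ k * t <= b.+1 * m.
  have := divn_eq m (b ^ k); have := ltn_pmod m bk0; rewrite /t mulnS mulSn mulnC.
  by lia.
have sX1H := subset_trans sX1 sXH; have sQ1H := subset_trans sQ1 sQH.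
have [||H1 [p1 [L1 [[[sH epp1] ext1 [cH1 cL1] od1 ch1] [sL1 _]]]]] :=
    @grow k H p X1 Hext sX1H.
- by move=> v _; exact: od.
- by rewrite cX1; move: bt capH; move: (b ^ k * t) (b.+1 * m) #|H| => u w h; clear; lia.
have sQ1H1 := subset_trans sQ1H sH.
have [||H2 [p2 [L2 [[[sH2 epp2] ext2 [cH2 cL2] od2 ch2] [sL2 _]]]]] :=
    @grow k H1 p1 Q1 ext1 sQ1H1.
(* The first forest adds no child to a vertex of [Q1] or to one outside [H1], so these can still
   afford [b] children. *)
- move=> v hv; apply: leq_trans (od v); rewrite leq_add2r; apply: od1.
  apply/orP; left; case/orP: hv => [vQ|vH1].
    rewrite in_setD (subsetP sQ1H) //= andbT; apply/negP => vX.
    have /disjoint_setI0/setP/(_ v) := dXQ.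
    by rewrite in_setI (subsetP sX1) // (subsetP sQ1) // in_set0.
  rewrite in_setD (negbTE vH1) andbF andbT; apply: contra vH1.
  by move=> /(subsetP sX1H)/(subsetP sH).
- by move: cH1 bt capH; rewrite cX1 cQ1; move: (b ^ k * t) (b.+1 * m) => u w; clear; lia.
have : L2 :&: nbr e L1 != set0.
  apply/eqP => E; have mL1 : m <= #|L1| by rewrite cL1 cX1; case/andP: bt => /ltnW.
  have : L2 \subset ~: nbr e L1.
    apply/subsetP => v vL2; rewrite in_setC; apply/negP => vN.
    by have /setP/(_ v) := E; rewrite in_setI vL2 vN in_set0.
  by move/subset_leq_card; have := joinedJ mL1; rewrite cL2 cQ1; case/andP: bt; clear; lia.
case/set0Pn=> c /setIP[cL2' /nbrP[a aL1 eac]].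
have [x [s1 [xX1 sz1 /and4P[ps1 /eqP ls1 us1 /allP as1]]]] := ch1 _ aL1.
have [q [s2 [qQ1 sz2 /and4P[ps2 /eqP ls2 us2 /allP as2]]]] := ch2 _ cL2'.
have s1H1 v : v \in s1 -> v \in H1 by move=> /as1; rewrite inE => /andP[].
have s2H2 v : v \in s2 -> v \in H2 by move=> /as2; rewrite inE => /andP[].
have [e2 _] := extP _ _ _ _ _ _ ext2.
(* The branch grown from [q] is traversed backwards, so its vertices are attached to their
   successors on the path. *)
have rE : rev (q :: s2) = c :: rev (belast q s2) by rewrite lastI rev_rcons ls2.
have vE : rcons (s1 ++ rev s2) q = s1 ++ rev (q :: s2) by rewrite rcons_cat rev_cons.
exists x; first exact: (subsetP sX1).
exists (s1 ++ rev s2), p2, q; split.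
- split; first by rewrite size_cat size_rev sz1 sz2 addnn.
    rewrite cat_uniq us1 rev_uniq us2 andbT /=; apply/hasPn => v.
    rewrite mem_rev => /as2; rewrite in_setD => /andP[vH1 _].
    by apply: contra vH1; exact: s1H1.
  move=> v; rewrite mem_cat mem_rev => /orP[/as1|/as2]; rewrite in_setD => /andP[] //.
  by move=> + _; apply: contra; exact: (subsetP sH).
- split; last exact: (subsetP sQ1).
  rewrite vE rE cat_path ls1 /= eac /=; apply/andP; split.
    have : all (mem H1) (x :: s1).
      apply/allP => v; rewrite in_cons => /orP[/eqP ->|/s1H1 //].
      exact/(subsetP sH)/(subsetP sX1H).
    move=> al; apply: (sub_in_path _ al ps1) => u w _ wH1 /= /eqP <-.
    by rewrite -(epp2 w wH1) e2 // (subsetP sH2).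
  rewrite -{1}ls2 rev_path.
  have : all (mem H2) (q :: s2).
    apply/allP => v; rewrite in_cons => /orP[/eqP ->|/s2H2 //].
    exact/(subsetP sH2)/(subsetP sQ1H1).
  move=> al; apply: (sub_in_path _ al ps2) => u w _ wH2 /= /eqP <-.
  by rewrite e_sym e2.
- split; first by move=> v vH; rewrite epp2 ?epp1 //; exact: (subsetP sH).
  apply: ext_rollback ext2 => //; rewrite subUset (subset_trans sH sH2) /=.
  apply/subsetP => v; rewrite inE mem_cat mem_rev => /orP[/s1H1|/s2H2] //.
  exact: (subsetP sH2).
- move=> i ik; rewrite vE.
  case: (ltnP i k) => [ltk|gek].
    left; rewrite -cat_cons !nth_cat /= sz1 ltk ltnS ltnW //.
    rewrite epp2; last by apply/s1H1/mem_nth; rewrite sz1.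
    by have /(pathP x)/(_ i) := ps1; rewrite sz1 => /(_ ltk)/eqP.
  right; rewrite !nth_cat sz1 ltnNge gek /= ltnNge (leqW gek) /=.
  have szr : size (q :: s2) = k.+1 by rewrite /= sz2.
  have [l1 l2 l3 l4] : [/\ i - k < k.+1, i.+1 - k < k.+1,
      k.+1 - (i - k).+1 = (k.+1 - (i.+1 - k).+1).+1 & k.+1 - (i.+1 - k).+1 < k].
    by move: ik gek; clear; split; lia.
  rewrite !nth_rev ?szr // l3.
  have lt : k.+1 - (i.+1 - k).+1 < size s2 by rewrite sz2.
  by have /(pathP x)/(_ _ lt)/eqP := ps2.
Qed.

End Linking.

(* [Q0] serves every vertex outside a maximal badly served set [B0], which has
   fewer than [m] elements; each vertex of [B0] gets a private neighbour. *)
Lemma reservoir (V : finType) (e : rel V) (D m cap : nat) :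
  0 < m -> 2 < D ->
  (forall X : {set V}, m <= #|X| -> #|~: nbr e X| < m) ->
  (forall X : {set V}, #|X| <= m.*2 -> D * #|X| <= #|nbr e X|) ->
  cap + m + m.*2 * D <= #|V| -> 4 * m <= cap ->
  exists (Q : {set V}) (w0 : V) (p : V -> V),
    [/\ w0 \notin Q, ext e setT D m (w0 |: Q) p, #|Q| <= 4 * m,
        forall v, outdeg (w0 |: Q) p v <= 3 &
        forall Y : {set V}, #|Y| <= m -> #|Y| <= #|nbr e Y :&: Q|].
Proof.
move=> m0 D2 J E capV cap4.
have x0 : V.
  have : 0 < #|V| by move: m0 capV; clear; lia.
  by case/card_gt0P/sig_eqW.
have ext0 : ext e setT D m set0 id by apply: ext0 => X _; exact: E.
have multi := @fp_multi V e setT D m cap m0 (joined_cap J capV).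
have c1 (s : seq V) x : uniq s -> count_mem x s <= 1.
  by move=> us; rewrite count_uniq_mem //; case: (_ \in _).
(* Any [3 * m] distinct parents will do for [Q0]. The factor 3 leaves every set of at least [m]
   vertices more than [2 * m] neighbours in [Q0]. *)
have szV : size (take (3 * m) (enum V)) = 3 * m.
  rewrite size_takel // -cardE.
  by apply: leq_trans capV; move: cap4; clear; lia.
have uV : uniq (take (3 * m) (enum V)) by rewrite take_uniq ?enum_uniq.
have [||||ws1 [p1 [sz1 [u1 d1] [_ ext1] nth1 od1]]] :=
    multi (take (3 * m) (enum V)) set0 id.
- exact: ext0.
- by rewrite cards0 szV; move: cap4; clear; lia.
- by move=> x _; rewrite inE.
- by move=> x _; rewrite outdeg0 add0n; exact: leq_trans (c1 _ _ uV) (ltnW (ltnW D2)).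
move: ext1 od1; rewrite set0U; set Q0 := [set w in ws1] => ext1 od1.
have cQ0 : #|Q0| = 3 * m by rewrite cardsE (card_uniqP u1) sz1 szV.
have od1' v : outdeg Q0 p1 v <= 1 by rewrite od1 outdeg0 c1.
pose bad (B : {set V}) := (#|B| <= m) && (#|nbr e B :&: Q0| <= #|B|).
have bad0 : bad set0.
  rewrite /bad cards0 /= leqn0 cards_eq0; apply/eqP/setP => w; rewrite in_set0.
  by apply/negbTE/negP => /setIP[/nbrP[x]]; rewrite in_set0.
case: (arg_maxnP (fun B : {set V} => #|B|) bad0) => B0 /andP[cB0 bB0] B0max.
have uB0 := enum_uniq B0.
have [||||ws2 [p2 [sz2 [u2 d2] [epp2 ext2] nth2 od2]]] := multi (enum B0) Q0 p1.
- exact: ext1.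
- by rewrite cQ0 -cardE; move: cB0 cap4; clear; lia.
- by move=> x _; rewrite inE.
- move=> x _; apply: leq_trans (leq_add (od1' x) (c1 _ _ uB0)) _.
  exact: ltnW.
move: ext2 od2; set Q1 := [set w in ws2]; set Q := Q0 :|: Q1 => ext2 od2.
have od2' v : outdeg Q p2 v <= 2 by rewrite od2 (leq_add (od1' v) (c1 _ _ uB0)).
have cQ1 : #|Q1| = #|B0| by rewrite cardsE (card_uniqP u2) sz2 -cardE.
have cQ : #|Q| <= 4 * m.
  by apply: leq_trans (leq_card_setU _ _) _; rewrite cQ0 cQ1; move: cB0; clear; lia.
(* [w0] is set aside outside [Q] as the future image of the root of the tree. *)
have [||||w0 [ew0 w0Q ext3]] := @fp_step V e setT D m cap m0 (joined_cap J capV) Q p2 x0.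
- exact: ext2.
- exact: leq_trans cQ cap4.
- by rewrite inE.
- exact: leq_ltn_trans (od2' x0) D2.
exists Q, w0, (upd p2 w0 x0); split=> //.
  move=> v; rewrite outdegU1 //.
  by apply: leq_trans (leq_add (od2' v) (leq_b1 _)) _.
move=> Y cY; pose Y0 := Y :&: B0; pose Y1 := Y :\: B0.
have h1 : #|Y1| <= #|nbr e Y1 :&: Q0|.
  have [->|Y1n] := posnP #|Y1|; first by [].
  have dis : #|B0 :|: Y1| = #|B0| + #|Y1|.
    have := cardsUI B0 Y1; rewrite /Y1 (_ : B0 :&: _ = set0) ?cards0 ?addn0 //.
    by apply/setP => v; rewrite !inE; case: (v \in B0).
  have cY1 : #|Y1| <= m by apply: leq_trans (subset_leq_card (subsetDl _ _)) cY.
  (* Either [B0 :|: Y1] is not bad by maximality, or it has more than [m] and at most [2 * m]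
     elements. Subtracting the at most [#|B0|] neighbours of [B0] leaves enough for [Y1]. *)
  have nb : #|B0 :|: Y1| < #|nbr e (B0 :|: Y1) :&: Q0|.
    case: (leqP #|B0 :|: Y1| m) => [le|gt].
      rewrite ltnNge; apply/negP => le2.
      have := B0max (B0 :|: Y1); rewrite /bad le le2 dis => /(_ isT).
      by move: Y1n; clear; lia.
    have := J _ (ltnW gt); have := cardsID (nbr e (B0 :|: Y1)) Q0.
    rewrite [Q0 :&: _]setIC cQ0.
    have : #|Q0 :\: nbr e (B0 :|: Y1)| <= #|~: nbr e (B0 :|: Y1)|.
      by apply/subset_leq_card/subsetP => v; rewrite !inE => /andP[].
    by move: dis cB0 cY1; clear; lia.
  have : #|nbr e (B0 :|: Y1) :&: Q0| <= #|nbr e B0 :&: Q0| + #|nbr e Y1 :&: Q0|.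
    by rewrite nbrU setIUl leq_card_setU.
  by move: nb bB0; rewrite dis; clear; lia.
have [e2 _] := extP _ _ _ _ _ _ ext2.
have h0 : #|Y0| <= #|nbr e Y0 :&: Q1|.
  have sub : Y0 \subset p2 @: (nbr e Y0 :&: Q1).
    apply/subsetP => y yY0; have /setIP[_ yB0] := yY0.
    have iy : index y (enum B0) < size (enum B0) by rewrite index_mem mem_enum.
    pose w := nth y ws2 (index y (enum B0)).
    have pw : p2 w = y by rewrite nth2 // nth_index // mem_enum.
    have wws : w \in ws2 by rewrite mem_nth // sz2.
    have wQ1 : w \in Q1 by rewrite inE.
    apply/imsetP; exists w; rewrite ?pw // in_setI wQ1 andbT.
    apply/nbrP; exists y => //; rewrite -{1}pw e2 //.
    by rewrite /Q in_setU wQ1 orbT.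
  exact: leq_trans (subset_leq_card sub) (leq_imset_card _ _).
have YE : Y = Y0 :|: Y1 by rewrite setID.
have sub : (nbr e Y1 :&: Q0) :|: (nbr e Y0 :&: Q1) \subset nbr e Y :&: Q.
  rewrite [X in nbr e X :&: Q]YE nbrU /Q; apply/subsetP => v; rewrite !(in_setU, in_setI).
  by case/orP => /andP[-> ->]; rewrite ?orbT.
apply: leq_trans (subset_leq_card sub).
have dis : (nbr e Y1 :&: Q0) :&: (nbr e Y0 :&: Q1) = set0.
  apply/setP => v; rewrite !(in_setI, in_set0); apply/negbTE/negP.
  by case/andP=> /andP[_ vQ0] /andP[_]; rewrite inE => /d2; rewrite vQ0.
rewrite cardsU dis cards0 subn0.
have := cardsID B0 Y; rewrite -/Y0 -/Y1 => <-.
by rewrite addnC leq_add.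
Qed.

(** * Rooted trees *)

(** As the root is its own parent, ancestors are the iterates of [par], and [fconnect par] is the
    ancestor relation. [dep] is fixed only up to a constant and serves as a measure. *)
Record rooting (T : sgraph) (root : T) (par : T -> T) (dep : T -> nat) : Prop :=
  Rooting {
    par_root : par root = root;
    par_adj : forall x, x != root -> adj x (par x);
    dep_par : forall x, x != root -> dep x = (dep (par x)).+1;
    adj_par : forall x y, adj x y ->
      (x != root) && (par x == y) || (y != root) && (par y == x) }.

(** [dep] is the distance to an arbitrary root and [par] a neighbour one step closer. *)
Lemma tree_rooting (T : sgraph) : is_tree T ->
  exists (root : T) par dep, rooting root par dep.
Proof.
move=> [[/card_gt0P[root _] conn] acyc].
pose reach x k := [exists s : k.-tuple T, path (@adj T) root s && (last root s == x)].
have reachI x s : path (@adj T) root s -> last root s = x -> reach x (size s).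
  move=> ps ls; apply/existsP; exists (in_tuple s).
  by rewrite ps /= ls eqxx.
have exk x : exists k, reach x k.
  by have /connectP[s ps ->] := conn root x; exists (size s); exact: reachI.
pose dep x := ex_minn (exk x).
have depP x : reach x (dep x) /\ forall k, reach x k -> dep x <= k.
  by rewrite /dep; case: ex_minnP.
have dep_adj x y : adj x y -> dep y <= (dep x).+1.
  move=> axy; have [/existsP[s /andP[ps /eqP ls]] _] := depP x.
  apply: (depP y).2; rewrite -[X in X.+1](size_tuple s) -(size_rcons s y).
  apply: reachI; last by rewrite last_rcons.
  by rewrite rcons_path ps ls.
have ex_par x : x != root -> exists y, adj x y && (dep x == (dep y).+1).
  move=> xr; have [/existsP[[s /= /eqP sz] /andP[ps /eqP ls]] _] := depP x.
  case/lastP: s sz ps ls => [|s y] sz ps ls.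
    by rewrite -ls eqxx in xr.
  rewrite last_rcons in ls; rewrite {y}ls in sz ps.
  move: ps; rewrite rcons_path => /andP[ps axl].
  exists (last root s); rewrite adj_sym axl /= eqn_leq dep_adj //=.
  by rewrite -sz size_rcons ltnS; apply: (depP _).2; exact: reachI.
pose par x := odflt x [pick y | adj x y && (dep x == (dep y).+1)].
have parP x : x != root -> adj x (par x) /\ dep x = (dep (par x)).+1.
  move=> /ex_par[y Py]; rewrite /par; case: pickP => [z /andP[? /eqP ?]|/(_ y)] //.
  by rewrite Py.
have dep0 : dep root = 0.
  apply/eqP; rewrite -leqn0; apply: (depP root).2; exact: (reachI _ [::]).
exists root, par, dep; split=> [|x /parP[]|x /parP[]|x y axy] //.
  by rewrite /par; case: pickP => [z /andP[_]|//]; rewrite dep0.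
(* Suppose the edge between [x] and [y] is not a parent edge. Parent edges alone join every vertex
   to the root, so a simple path joins [x] and [y] without this edge, and the edge closes it to a
   cycle. *)
apply/negPn/negP; rewrite negb_or !negb_and !negbK => /andP[hx hy].
pose e' := [rel a c : T | adj a c && ~~ ((a == x) && (c == y) || (a == y) && (c == x))].
have e'sym : symmetric e'.
  by move=> a c; rewrite /= adj_sym orbC ![(_ == x) && _]andbC.
have toroot z : connect e' z root.
  have [k] := ubnP (dep z); elim: k z => // k IH z.
  have [-> _|zr lt] := eqVneq z root; first exact: connect0.
  have [azp dz] := parP z zr.
  apply: (@connect_trans _ _ (par z)); last by apply: IH; rewrite -ltnS -dz.
  apply: connect1; rewrite /= azp /=; apply/negP.
  by case/orP => /andP[/eqP E /eqP Ep]; subst z; rewrite Ep eqxx (negbTE zr) in hx hy.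
have : connect e' x y.
  by apply: connect_trans (toroot x) _; rewrite sym_connect_sym.
case/connectP=> s0 ps0 ly; case/shortenP: ps0 ly => s ps us _ ly.
have sub : path (@adj T) x s by apply: sub_path ps => a c /= /andP[].
have : ucycle (@adj T) (x :: s).
  by rewrite /ucycle us andbT /= rcons_path sub -ly adj_sym.
move/acyc; case: s ps ly {us sub} => [|a [|c s]] //=.
  by move=> _ E; rewrite E adj_irr in axy.
by rewrite andbT => /andP[_ /negP h] E _; case: h; rewrite -E !eqxx.
Qed.

Section RootedTree.
Variables (T : sgraph) (root : T) (par : T -> T) (dep : T -> nat) (Delta : nat).
Hypothesis rT : rooting root par dep.
Hypothesis deg_le : forall x : T, deg x <= Delta.
Hypothesis Delta_gt1 : 1 < Delta.
Implicit Types (x y z v c : T).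

Definition children v := [set c | (c != root) && (par c == v)].

Lemma card_children v : #|children v| <= Delta.
Proof.
apply: leq_trans (deg_le v); apply/subset_leq_card/subsetP => c.
rewrite !inE => /andP[cr /eqP <-]; by rewrite adj_sym (par_adj rT).
Qed.

Lemma fconnect_dep x y : fconnect par x y -> x = y \/ dep y < dep x.
Proof.
move=> /iter_findex <-; elim: (findex par x y) => [|i IH] /=; first by left.
have [E|ne] := eqVneq (iter i par x) root.
  by rewrite E (par_root rT) -E.
have := dep_par rT ne; case: IH => [<- ->|]; first by right.
by move=> lt E; right; apply: leq_trans lt; rewrite E.
Qed.

Lemma fconnect_anti x y : fconnect par x y -> fconnect par y x -> x = y.
Proof.
move=> /fconnect_dep[//|lt] /fconnect_dep[//|lt2].
by have := ltn_trans lt lt2; rewrite ltnn.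
Qed.

Lemma fconnect_root x : fconnect par x root.
Proof.
have [k] := ubnP (dep x); elim: k x => // k IH x lt.
have [->|xr] := eqVneq x root; first exact: connect0.
apply: connect_trans (fconnect1 _ _) (IH _ _).
by rewrite -ltnS -(dep_par rT xr).
Qed.

Definition desc v := [set x | fconnect par x v].
(** Cutting at [v] keeps [v] in the upper piece, the complement, which is closed under [par]. *)
Definition sdesc v := desc v :\ v.

Lemma sdesc_par v c : par c \in sdesc v -> c \in sdesc v.
Proof.
rewrite !inE => /andP[ne cv]; have cv' := connect_trans (fconnect1 par c) cv.
rewrite cv' andbT; apply: contra ne => /eqP E; rewrite E in cv.
by rewrite E eq_sym; apply/eqP/(fconnect_anti (fconnect1 par v) cv).
Qed.

Lemma sdesc_sub v v' : v' \in desc v -> sdesc v' \subset sdesc v.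
Proof.
rewrite inE => v'v; apply/subsetP => x; rewrite !inE => /andP[ne xv'].
rewrite (connect_trans xv' v'v) andbT; apply: contra ne => /eqP E.
by apply/eqP/(fconnect_anti xv'); rewrite E.
Qed.

Lemma sdesc_root : ~: sdesc root = [set root].
Proof. by apply/setP => x; rewrite !inE fconnect_root andbT negbK. Qed.

Lemma sdesc_traject v l z t : t \in traject par z l -> t \in sdesc v -> z \in sdesc v.
Proof.
move=> /trajectP[i _ ->] {l t}; elim: i => [|i IH] //= h.
by apply: IH; exact: sdesc_par.
Qed.

Definition near v l := [set x | v \in traject par x l].

(** By induction there are at most [1 + Delta * (Delta ^ l - 1)] vertices for [l.+1], fewer than
    [Delta ^ l.+1] because [Delta > 1]. *)
Lemma card_near v l : #|near v l| < Delta ^ l.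
Proof.
elim: l v => [|l IH] v.
  by rewrite expn0 ltnS leqn0 cards_eq0; apply/eqP/setP => x; rewrite !inE.
have sub : near v l.+1 \subset v |: \bigcup_(c in children v) near c l.
  apply/subsetP => x; rewrite inE in_setU1 => /trajectP[i il ->].
  elim: i il => [|i IHi] il /=; first by rewrite eqxx.
  have [E|ne] := eqVneq (iter i par x) root.
    by rewrite E (par_root rT) -E; apply: IHi; exact: ltnW.
  apply/orP; right; apply/bigcupP; exists (iter i par x).
    by rewrite inE ne eqxx.
  by rewrite inE; apply/trajectP; exists i.
apply: leq_ltn_trans (subset_leq_card sub) _.
apply: leq_ltn_trans (leq_card_setU _ _) _; rewrite cards1.
have : #|\bigcup_(c in children v) near c l| <= \sum_(c in children v) (Delta ^ l).-1.
  apply: leq_trans (card_bigcup_sum _ _) _.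
  by apply: leq_sum => c _; have := IH c; case: (Delta ^ l).
rewrite sum_nat_const => le.
have : #|children v| * (Delta ^ l).-1 <= Delta * (Delta ^ l).-1.
  by rewrite leq_mul2r card_children orbT.
have : Delta * (Delta ^ l).-1 = Delta ^ l.+1 - Delta.
  by rewrite expnS -subn1 mulnBr muln1.
have : Delta <= Delta ^ l.+1 by rewrite expnS leq_pmulr // expn_gt0 ltnW.
by move: le Delta_gt1; clear; lia.
Qed.

(** * Disjoint ancestor paths and balanced cuts *)

Definition trdisj l (Z : {set T}) := [forall z in Z, forall z' in Z,
  (z != z') ==> ~~ has [in traject par z l] (traject par z' l)].

Lemma trdisjP l (Z : {set T}) : reflect
  (forall z z' t, z \in Z -> z' \in Z -> t \in traject par z l ->
     t \in traject par z' l -> z = z') (trdisj l Z).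
Proof.
apply: (iffP forall_inP) => [h z z' t zZ z'Z tz tz'|h z zZ].
  apply/eqP/negPn/negP => ne; have /forall_inP/(_ z' z'Z)/implyP/(_ ne) := h z zZ.
  by case/hasP; exists t.
apply/forall_inP => z' z'Z; apply/implyP => ne; apply/hasP => -[t tz' tz].
by case/negP: ne; apply/eqP; apply: h tz tz'.
Qed.

(** For a maximal family [Z] the path of every [y] in [Y] meets that of some [z], which puts [y]
    near one of the [l.+1] vertices of the latter. *)
Lemma select_disjoint l (Y : {set T}) : exists2 Z : {set T},
  Z \subset Y /\ trdisj l.+1 Z & #|Y| <= #|Z| * (l.+1 * Delta ^ l.+1).
Proof.
pose P (Z : {set T}) := (Z \subset Y) && trdisj l.+1 Z.
have P0 : P set0.
  by rewrite /P sub0set; apply/trdisjP => z z' t; rewrite in_set0.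
case: (arg_maxnP (fun Z : {set T} => #|Z|) P0) => Z /andP[sZ /trdisjP dZ] Zmax.
exists Z; first by split=> //; apply/trdisjP.
have cover : Y \subset \bigcup_(z in Z) \bigcup_(i < l.+1) near (iter i par z) l.+1.
  apply/subsetP => y yY.
  have [z zZ [t tz ty]] : exists2 z, z \in Z &
      exists2 t, t \in traject par z l.+1 & t \in traject par y l.+1.
    have [yZ|yZ] := boolP (y \in Z).
      by exists y => //; exists y; rewrite trajectS mem_head.
    have [|none] := boolP [exists z in Z,
        has [in traject par z l.+1] (traject par y l.+1)].
      by case/exists_inP=> z zZ /hasP[t ty tz]; exists z => //; exists t.
    have ny z t : z \in Z -> t \in traject par z l.+1 ->
        t \in traject par y l.+1 -> False.
      move=> zZ tz ty; case/negP: none; apply/exists_inP; exists z => //.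
      by apply/hasP; exists t.
    suff h : P (y |: Z) by move: (Zmax _ h) => /=; rewrite cardsU1 yZ add1n ltnn.
    rewrite /P subUset sub1set yY sZ /=; apply/trdisjP => z z' t.
    rewrite !in_setU1 => /orP[/eqP ->|zZ] /orP[/eqP ->|z'Z] // tz tz'.
    - by case: (ny z' t).
    - by case: (ny z t).
    - exact: dZ tz tz'.
  case/trajectP: tz => i il E; apply/bigcupP; exists z => //.
  by apply/bigcupP; exists (Ordinal il); rewrite //= -E inE.
apply: leq_trans (subset_leq_card cover) _; apply: card_bigcup_le => z _.
rewrite -[X in _ <= X * _]card_ord; apply: card_bigcup_le => i _.
exact: ltnW (card_near _ _).
Qed.

Definition weight (Y : {set T}) v := #|Y :&: desc v|.

(** Take the deepest descendant [u] with more than half of the weight. Its children have at most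
    half each, and one has a [4 * Delta]-th, as otherwise [u] would have at most one more than a
    quarter. *)
Lemma split_weight (Y : {set T}) v : 2 < weight Y v -> exists v',
  [/\ v' \in desc v, weight Y v <= 4 * Delta * weight Y v' &
      2 * weight Y v' <= weight Y v].
Proof.
set w := weight Y v => w2.
pose P u := (u \in desc v) && (w < 2 * weight Y u).
have Pv : P v.
  by rewrite /P inE connect0 /= -/w; move: w2; clear; lia.
case: (arg_maxnP dep Pv) => u /andP[uv wu] umax.
have [|none] := boolP [exists c in children u, w <= 4 * Delta * weight Y c].
  case/exists_inP=> c cu wc; exists c.
  have pc : par c = u by move: cu; rewrite inE => /andP[_ /eqP].
  have cr : c != root by move: cu; rewrite inE => /andP[].
  have cv : c \in desc v.
    rewrite inE; apply: connect_trans (fconnect1 par c) _; rewrite pc.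
    by move: uv; rewrite inE.
  split=> //; rewrite leqNgt; apply/negP => h.
  have Pc : P c by rewrite /P cv.
  by move: (umax c Pc) => /=; rewrite (dep_par rT cr) pc ltnn.
exfalso.
have sub : Y :&: desc u \subset u |: \bigcup_(c in children u) (Y :&: desc c).
  apply/subsetP => x /setIP[xY]; rewrite inE => /iter_findex E.
  rewrite in_setU1; elim: (findex par x u) E => [|i IHi] /=.
    by move=> ->; rewrite eqxx.
  move=> E; have [Er|ne] := eqVneq (iter i par x) root.
    by apply: IHi; rewrite -E Er (par_root rT).
  apply/orP; right; apply/bigcupP; exists (iter i par x).
    by rewrite inE ne E eqxx.
  by rewrite !inE xY fconnect_iter.
have := subset_leq_card sub; rewrite -/(weight Y u).
move/leq_trans => /(_ _ (leq_card_setU _ _)); rewrite cards1.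
have : #|\bigcup_(c in children u) (Y :&: desc c)| <= \sum_(c in children u) weight Y c.
  exact: card_bigcup_sum.
have : Delta * (4 * \sum_(c in children u) weight Y c) <= Delta * w.
  apply: leq_trans (_ : \sum_(c in children u) w <= _); last first.
    by rewrite sum_nat_const leq_mul2r card_children orbT.
  rewrite !big_distrr; apply: leq_sum => c cu.
  rewrite /= mulnA [Delta * 4]mulnC leqNgt; apply/negP => /ltnW h.
  by case/negP: none; apply/exists_inP; exists c.
rewrite leq_pmul2l; last exact: ltnW.
by move: wu w2; clear; lia.
Qed.

End RootedTree.

(** * Covering the reservoir *)

(** Here [w] and [w'] are the weights at the two cuts bounding a block, [n] counts the usable
    parents between them, [z] the disjoint paths and [r] the uncovered vertices. Up to block [k] the
    cuts cost [(4 * Delta) ^ k] and the selection of paths [(Delta ^ 2) ^ k] times a linear factor,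
    absorbed by [2 ^ k]; the product [(8 * Delta ^ 3) ^ k] is at most the gain [b ^ k]. *)
Lemma block_count Delta b m kap k (w w' n r z : nat) :
  1 < Delta -> 0 < m -> 8 * Delta ^ 3 <= b -> 6 * b * Delta ^ 2 < kap ->
  kap * m <= w * (4 * Delta) ^ k -> r * b ^ k <= b * m -> b ^ k <= b * m ->
  2 * w' <= w -> w <= w' + Delta ^ k.*2.+1 + n ->
  n <= z * (k.*2.+2 * Delta ^ k.*2.+2) -> r <= z.
Proof.
move=> D1 m0 b_ge kap_gt wk rk bkm ww' wn nz; rewrite leqNgt; apply/negP => zr.
have D0 : 0 < Delta by exact: ltnW.
have b0 : 0 < b by apply: leq_trans b_ge; rewrite muln_gt0 expn_gt0 D0.
have bk0 : 0 < b ^ k by rewrite expn_gt0 b0.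
set X := Delta ^ k.*2.+2 in nz.
have XD : Delta ^ k.*2.+1 <= X by rewrite leq_exp2l.
have h1 : w <= 2 * X + 2 * n by move: ww' wn XD; clear; lia.
have e1 : X * b ^ k <= b * m * X by rewrite mulnC leq_mul2r bkm orbT.
have e2 : n * b ^ k <= b * m * (k.*2.+2 * X).
  apply: leq_trans (leq_mul nz (leqnn (b ^ k))) _; rewrite mulnAC leq_mul2r.
  by apply/orP; right; apply: leq_trans rk; rewrite leq_mul2r ltnW ?orbT.
have h2 : w * b ^ k <= b * m * (X * (4 * k + 6)).
  have : w * b ^ k <= (2 * X + 2 * n) * b ^ k by rewrite leq_mul2r h1 orbT.
  have -> : b * m * (X * (4 * k + 6)) = 2 * (b * m * X) + 2 * (b * m * (k.*2.+2 * X)).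
    by rewrite -mul2n; clear; ring.
  by move: e1 e2; rewrite mulnDl -!mulnA; clear; lia.
have k2 : 4 * k + 6 <= 6 * 2 ^ k.
  by elim: (k) => // j IH; rewrite expnS; move: IH; clear; lia.
have XE : X = Delta ^ 2 * (Delta ^ 2) ^ k.
  by rewrite /X -expnM -expnD; congr (_ ^ _); rewrite -mul2n; clear; lia.
have h3 : X * (4 * k + 6) * (4 * Delta) ^ k <= 6 * Delta ^ 2 * b ^ k.
  apply: leq_trans (_ : X * (6 * 2 ^ k) * (4 * Delta) ^ k <= _).
    by rewrite leq_mul2r leq_mul2l k2 !orbT.
  have -> : X * (6 * 2 ^ k) * (4 * Delta) ^ k = 6 * Delta ^ 2 * (8 * Delta ^ 3) ^ k.
    rewrite XE (_ : 8 * Delta ^ 3 = Delta ^ 2 * 2 * (4 * Delta)).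
      by rewrite !expnMn; clear; ring.
    by clear; ring.
  rewrite leq_mul2l; apply/orP; right.
  by have [->//|k0] := posnP k; rewrite leq_exp2r.
have : kap * m * b ^ k <= b * m * (6 * Delta ^ 2 * b ^ k).
  apply: leq_trans (leq_mul wk (leqnn _)) _; rewrite mulnAC.
  apply: leq_trans (leq_mul h2 (leqnn _)) _.
  by rewrite -[X in X <= _]mulnA leq_mul2l h3 orbT.
rewrite -mulnA mulnCA -[X in _ <= X]mulnA !mulnA [b * m]mulnC -!mulnA leq_pmul2l //.
rewrite !mulnA leq_pmul2r // leqNgt => /negP; apply.
by apply: leq_trans kap_gt; rewrite ltnS leq_eqVlt; apply/orP; left; apply/eqP; ring.
Qed.

Section Embedding.
Variables (T : sgraph) (root : T) (par : T -> T) (dep : T -> nat) (Delta : nat).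
Hypothesis rT : rooting root par dep.
Hypothesis deg_le : forall x : T, deg x <= Delta.
Hypothesis Delta_gt1 : 1 < Delta.

Variables (V : finType) (e : rel V) (D m cap b : nat).
Hypothesis e_sym : symmetric e.
Hypothesis m_gt0 : 0 < m.
Hypothesis b_gt1 : 1 < b.
Hypothesis D_ge : Delta + 3 + b <= D.
Hypothesis joinedJ : forall X : {set V}, m <= #|X| -> #|~: nbr e X| < m.
Hypothesis cap_le : cap + m + m.*2 * D <= #|V|.

Variables (Q : {set V}) (w0 : V) (p0 : V -> V).
Hypothesis w0Q : w0 \notin Q.
Hypothesis ext_Q : ext e setT D m (w0 |: Q) p0.
Hypothesis outdeg_Q : forall v, outdeg (w0 |: Q) p0 v <= 3.

Variables (Tp Y : {set T}).
Hypothesis Tp_root : root \in Tp.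
Hypothesis Tp_par : forall c, c \in Tp -> par c \in Tp.
Hypothesis Y_Tp : Y \subset Tp.
Hypothesis cap_Tp : #|Tp| + #|Q| + 4 * (b.+1 * m) <= cap.

Implicit Types (S : {set T}) (phi : T -> V) (p : V -> V).

(** The whole reservoir counts as used from the start, so that only a deliberate link can end in
    it. *)
Definition used S phi := phi @: S :|: Q.
Definition uncovered S phi := Q :\: phi @: S.

(* [phi] embeds the subtree [S], keeping the vertices of [Q] for [Y]; the map
   [p] records the edges along which the used vertices were attached, possibly
   against the orientation of the tree. *)
Definition embeds S phi p :=
  [/\ [/\ root \in S, S \subset Tp & forall c, c \in S -> par c \in S],
      {in S &, injective phi} /\ phi root = w0,
      forall c, c \in S -> c != root -> e (phi (par c)) (phi c),
      forall c, c \in S -> phi c \in Q -> c \in Y &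
      [/\ {in w0 |: Q, p =1 p0},
          forall c, c \in S -> phi c \notin w0 |: Q ->
            exists c', [/\ c' \in S, adj c' c & p (phi c) = phi c'] &
          ext e setT D m (used S phi) p]].

Lemma w0Q_used S phi p : embeds S phi p -> w0 |: Q \subset used S phi.
Proof.
case=> [[rS _ _] [_ pr] _ _ _]; rewrite subUset sub1set subsetUr andbT in_setU.
by rewrite -pr imset_f.
Qed.

Lemma card_used S phi p : embeds S phi p -> #|used S phi| + 4 * (b.+1 * m) <= cap.
Proof.
case=> [[_ sS _] _ _ _ _]; apply: leq_trans cap_Tp; rewrite leq_add2r.
apply: leq_trans (leq_card_setU _ _) _; rewrite leq_add2r.
exact: leq_trans (leq_imset_card _ _) (subset_leq_card sS).
Qed.

(** Whatever is attached to [phi c] outside [w0 |: Q] is the image of a tree neighbour of [c], in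
    either direction; [w0 |: Q] adds at most 3. *)
Lemma outdeg_used S phi p v : embeds S phi p ->
  outdeg (used S phi) p v <= Delta + 3.
Proof.
case=> [_ [inj pr] _ _ [pp0 pc _]].
have sub : [set w in used S phi | p w == v] \subset
    [set w in [set w in used S phi | p w == v] | w \notin w0 |: Q] :|:
    [set w in w0 |: Q | p0 w == v].
  apply/subsetP => w wu; rewrite in_setU.
  have [wQ|wQ] := boolP (w \in w0 |: Q); last by rewrite inE wu wQ.
  move: wu; rewrite inE => /andP[_ pw].
  by apply/orP; right; rewrite inE wQ -pp0.
apply: leq_trans (subset_leq_card sub) _.
apply: leq_trans (leq_card_setU _ _) _; apply: leq_add (outdeg_Q v).
set W := [set w in _ | _].
have [->|[w1 w1W]] := set_0Vmem W; first by rewrite cards0.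
have WP w : w \in W -> exists c c', [/\ c \in S, w = phi c, c' \in S, adj c' c & v = phi c'].
  rewrite inE => /andP[]; rewrite inE => /andP[wu /eqP pw] wQ.
  have /imsetP[c cS wE] : w \in phi @: S.
    move: wu; rewrite in_setU => /orP[//|wQ'].
    by case/negP: wQ; rewrite in_setU1 wQ' orbT.
  rewrite wE in wQ pw; have [c' [c'S acc E]] := pc _ cS wQ.
  by exists c, c'; split=> //; rewrite -pw.
have [_ [c1 [_ _ c1S _ vE]]] := WP _ w1W.
apply: leq_trans (deg_le c1).
apply: leq_trans (leq_imset_card phi [set y | adj c1 y]).
apply/subset_leq_card/subsetP => w /WP[c [c' [cS -> c'S acc E]]].
apply: imset_f; rewrite inE -(inj c' c1) // -E; exact: vE.
Qed.

Lemma embed_vertex S phi p c : embeds S phi p -> c \in Tp -> c \notin S ->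
  par c \in S -> c != root ->
  exists phi' p', [/\ embeds (c |: S) phi' p', {in S, phi' =1 phi},
    {in used S phi, p' =1 p}, used S phi \subset used (c |: S) phi' &
    uncovered (c |: S) phi' \subset uncovered S phi].
Proof.
move=> emb cTp cS pcS cr; have cap' := card_used emb.
have [||||w [epw wu extw]] := @fp_step V e setT D m cap m_gt0
    (joined_cap joinedJ cap_le) (used S phi) p (phi (par c)).
- by case: emb => _ _ _ _ [].
- by move: cap'; clear; lia.
- by rewrite inE.
- by have := outdeg_used (phi (par c)) emb; move: D_ge b_gt1; clear; lia.
have sQu := w0Q_used emb.
case: emb => [[rS sS clS] [inj pr] ed QY [pp0 pc _]].
pose phi' := upd phi c w; pose p' := upd p w (phi (par c)).
have phiS : {in S, phi' =1 phi}.
  by move=> x xS; rewrite /phi' /upd; case: eqP => // E; rewrite -E xS in cS.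
have phic : phi' c = w by rewrite /phi' /upd eqxx.
have im : phi' @: (c |: S) = w |: phi @: S.
  by rewrite imsetU1 phic; congr (_ |: _); apply: eq_in_imset.
have usedE : used (c |: S) phi' = w |: used S phi by rewrite /used im setUA.
have pu : {in used S phi, p' =1 p}.
  by move=> x xu; rewrite /p' /upd; case: eqP => // E; rewrite -E xu in wu.
have wS x : x \in S -> phi x != w.
  move=> xS; apply: contra wu => /eqP <-.
  by rewrite in_setU imset_f.
exists phi', p'; split=> //; last 2 first.
- by rewrite usedE subsetUr.
- by rewrite /uncovered im; apply: setDS; exact: subsetUr.
split.
- split; first by rewrite in_setU1 rS orbT.
    by rewrite subUset sub1set cTp.
  by move=> x; rewrite !in_setU1 => /orP[/eqP ->|/clS ->]; rewrite ?pcS orbT.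
- split; last by rewrite phiS.
  move=> x y; rewrite !in_setU1 => /orP[/eqP ->|xS] /orP[/eqP ->|yS] //.
  + by rewrite phic phiS // => E; have := wS _ yS; rewrite E eqxx.
  + by rewrite phic phiS // => E; have := wS _ xS; rewrite E eqxx.
  + by rewrite !phiS //; exact: inj.
- move=> x; rewrite in_setU1 => /orP[/eqP ->|xS] xr; first by rewrite phic phiS.
  by rewrite !phiS ?clS //; exact: ed.
- move=> x; rewrite in_setU1 => /orP[/eqP ->|xS].
    by rewrite phic => wQ; case/negP: wu; rewrite in_setU wQ orbT.
  by rewrite phiS //; exact: QY.
- split.
  + by move=> x xQ; rewrite pu ?pp0 //; exact: (subsetP sQu).
  + move=> x; rewrite in_setU1 => /orP[/eqP ->|xS].
      rewrite phic => _; exists (par c); split; first by rewrite in_setU1 pcS orbT.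
        by rewrite adj_sym (par_adj rT).
      by rewrite /p' /upd eqxx phiS.
    rewrite phiS // => xQ; have [c' [c'S acc E]] := pc _ xS xQ.
    exists c'; rewrite in_setU1 c'S orbT phiS //; split=> //.
    by rewrite pu // in_setU imset_f.
  + by rewrite usedE.
Qed.

(** The tree path [cs] from below [g] down to [z] is laid along the link from [phi g], so [z] lands
    on an uncovered vertex of [Q], as is allowed for elements of [Y]. *)
Lemma embed_path S phi p g cs z k : embeds S phi p -> g \in S ->
  path (fun a c => par c == a) g cs -> uniq cs -> last g cs = z -> z \in Y ->
  size cs = k.*2.+1 -> (forall c, c \in cs -> c \in Tp :\: S) ->
  linkable e D m (used S phi) p (uncovered S phi) (phi g) k ->
  exists phi' p', let S' := S :|: [set c in cs] in
    [/\ embeds S' phi' p', {in S, phi' =1 phi},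
    {in used S phi, p' =1 p}, used S phi \subset used S' phi' &
    #|uncovered S' phi'| < #|uncovered S phi| /\
    uncovered S' phi' \subset uncovered S phi].
Proof.
move=> emb gS pcs ucs lz zY szc csT.
move=> [vs [p' [q [[szv uvs dvs] [pvs qun] [pu extu] lk]]]].
have sQu := w0Q_used emb.
have [qQ qS] : q \in Q /\ q \notin phi @: S by move: qun; rewrite inE => /andP[].
case: emb => [[rS sS clS] [inj pr] ed QY [pp0 pc _]].
pose im := rcons vs q; pose x0 := phi g.
have szim : size im = size cs by rewrite size_rcons szv szc.
pose phi' t := if t \in cs then nth x0 im (index t cs) else phi t.
have csS c : c \in cs -> c \notin S by move=> /csT; rewrite inE => /andP[].
have phiS : {in S, phi' =1 phi}.
  by move=> t tS; rewrite /phi'; case: ifP => // /csS; rewrite tS.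
have phics i : i < size cs -> phi' (nth g cs i) = nth x0 im i.
  by move=> lt; rewrite /phi' mem_nth // index_uniq.
have phigs i : i <= size cs -> phi' (nth g (g :: cs) i) = nth x0 (x0 :: im) i.
  by case: i => [_|i] /=; [rewrite phiS | exact: phics].
have uim : uniq im.
  rewrite rcons_uniq uvs andbT; apply/negP => /dvs; case/negP.
  by rewrite in_setU qQ orbT.
have imS v : v \in im -> v \notin phi @: S.
  rewrite mem_rcons in_cons => /orP[/eqP -> //|/dvs].
  by rewrite in_setU negb_or => /andP[].
have memcs c : c \in cs -> exists2 i, i < size cs & c = nth g cs i.
  by move=> cc; exists (index c cs); rewrite ?index_mem ?nth_index.
have parcs i : i < size cs -> par (nth g cs i) = nth g (g :: cs) i.
  by move=> lt; have /(pathP g)/(_ _ lt)/eqP := pcs.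
pose S' := S :|: [set c in cs].
have S'P c : c \in S' -> c \in S \/ exists2 i, i < size cs & c = nth g cs i.
  by rewrite in_setU => /orP[|]; [left | rewrite inE => /memcs; right].
have gsS' i : i <= size cs -> nth g (g :: cs) i \in S'.
  case: i => [_|i lt] /=; rewrite in_setU ?gS // inE.
  by rewrite mem_nth ?orbT.
have imE : phi' @: S' = phi @: S :|: [set v in im].
  rewrite imsetU (eq_in_imset phiS); congr (_ :|: _); apply/setP => v.
  rewrite inE; apply/imsetP/idP.
    case=> c; rewrite inE => /memcs[i lt ->] ->.
    by rewrite phics // mem_nth // szim.
  move=> vim; exists (nth g cs (index v im)).
    by rewrite inE mem_nth // -szim index_mem.
  by rewrite phics ?nth_index // -szim index_mem.
have usedE : used S' phi' = used S phi :|: [set v in vs].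
  rewrite /used imE; apply/setP => v; rewrite !in_setU !inE mem_rcons in_cons.
  case: eqP => [->|_] /=; first by rewrite qQ !orbT.
  by rewrite -!orbA; congr (_ || _); rewrite orbC.
exists phi', p'; rewrite -/S'.
have sU : uncovered S' phi' \subset uncovered S phi.
  by rewrite /uncovered imE; apply: setDS; exact: subsetUl.
split=> //; last 2 first.
- by rewrite usedE subsetUl.
- split=> //; apply/proper_card/properP; split=> //; exists q => //.
  rewrite /uncovered imE !inE mem_rcons mem_head !orbT //.
split.
- split; first by rewrite in_setU rS.
    rewrite subUset sS; apply/subsetP => c; rewrite inE => /csT.
    by rewrite inE => /andP[].
  move=> c /S'P[cS|[i lt ->]]; first by rewrite in_setU clS.
  by rewrite parcs // gsS' // ltnW.
- split; last by rewrite phiS.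
  have dif c i : c \in S -> i < size cs -> phi c = nth x0 im i -> False.
    move=> cS lt E; have /imS : nth x0 im i \in im by rewrite mem_nth // szim.
    by rewrite -E imset_f.
  move=> x y /S'P[xS|[i lti ->]] /S'P[yS|[j ltj ->]].
  + by rewrite !phiS //; exact: inj.
  + by rewrite phiS // phics // => /dif; case.
  + by rewrite phics // phiS // => /esym/dif; case.
  + rewrite !phics // => /eqP; rewrite nth_uniq ?szim // => /eqP -> //.
- move=> c /S'P[cS|[i lt ->]] cr; first by rewrite !phiS ?clS //; exact: ed.
  rewrite parcs // phigs ?phics //; last exact: ltnW.
  by have /(pathP x0)/(_ i) := pvs; rewrite szim; apply.
- move=> c /S'P[cS|[i lt ->]]; first by rewrite phiS //; exact: QY.
  rewrite phics // /im nth_rcons szv; case: ltnP => [ltk|gek].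
    have /dvs : nth x0 vs i \in vs by rewrite mem_nth // szv.
    by rewrite in_setU negb_or => /andP[_ /negP].
  move=> _; suff -> : nth g cs i = z by [].
  rewrite -lz (last_nth g) szc /=; congr nth.
  by move: lt gek; rewrite szc; clear; lia.
- split; last by rewrite usedE.
    by move=> x xQ; rewrite pu ?pp0 //; exact: (subsetP sQu).
  move=> c /S'P[cS|[i lt ->]].
    rewrite phiS // => cQ; have [c' [c'S acc E]] := pc _ cS cQ.
    exists c'; rewrite in_setU c'S phiS //; split=> //.
    by rewrite pu // in_setU imset_f.
  rewrite phics //; have [ltk|gek] := ltnP i k.*2; last first.
    rewrite /im nth_rcons szv ltnNge gek /=.
    have -> : i == k.*2 by rewrite eqn_leq gek andbT -ltnS -szc.
    by rewrite in_setU1 qQ orbT.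
  move=> _; case: (lk i ltk) => E.
    exists (nth g (g :: cs) i); split; first by rewrite gsS' // ltnW.
      rewrite -parcs // adj_sym (par_adj rT) //; apply/eqP => E2.
      by have := csS _ (mem_nth g lt); rewrite E2 rS.
    by rewrite phigs // ltnW.
  have lt1 : i.+1 < size cs by rewrite szc ltnS.
  exists (nth g cs i.+1); split; first exact: (gsS' i.+2).
    rewrite -[X in adj _ X](parcs _ lt1) (par_adj rT) //; apply/eqP => E2.
    by have := csS _ (mem_nth g lt1); rewrite E2 rS.
  by rewrite phics.
Qed.

(** The next vertex is always one of least depth. [F] collects the starting points of failed links,
    which stay failed by [linkable_mono]. Each [z] in [Z] is charged once: it covers a vertex of [Q]
    or enlarges [F]. *)
Lemma embed_phase k S' N S phi p (Z F : {set T}) :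
  S' \subset Tp -> (forall c, c \in S' -> par c \in S') ->
  #|S' :\: S| <= N -> embeds S phi p -> S \subset S' ->
  Z \subset Y -> trdisj par k.*2.+2 Z ->
  (forall z t, z \in Z -> t \in traject par z k.*2.+1 -> t \in S' :\: S) ->
  F \subset S ->
  (forall g, g \in F -> ~ linkable e D m (used S phi) p (uncovered S phi) (phi g) k) ->
  (forall z, z \in Z -> iter k.*2.+1 par z \notin F) ->
  exists phi' p' (F' : {set T}),
    [/\ embeds S' phi' p', F' \subset S',
        forall g, g \in F' ->
          ~ linkable e D m (used S' phi') p' (uncovered S' phi') (phi' g) k,
        #|F| + #|Z| + #|uncovered S' phi'| <= #|F'| + #|uncovered S phi| &
        #|uncovered S' phi'| <= #|uncovered S phi|].
Proof.
move=> sS' clS'; elim: N S phi p Z F => [|N IH] S phi p Z F cN emb sS sZ dZ ZS sF Fnl ZF.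
  have SE : S = S'.
    by apply/eqP; rewrite eqEsubset sS -setD_eq0 -cards_eq0 -leqn0.
  have Z0 : Z = set0.
    apply/setP => z; rewrite in_set0; apply/negbTE/negP => zZ.
    by have := ZS z z zZ; rewrite trajectS mem_head SE setDv in_set0 => /(_ isT).
  exists phi, p, F; rewrite SE in emb sF Fnl *; split=> //.
  by rewrite Z0 cards0 addn0.
have [S0|[c0 c0S]] := set_0Vmem (S' :\: S).
  by apply: (IH S phi p Z F) => //; rewrite S0 cards0.
case: (arg_minnP dep (c0S : [in S' :\: S] c0)) => c cS cmin.
have [cS' cnS] : c \in S' /\ c \notin S by move: cS; rewrite inE => /andP[].
have rS : root \in S by case: emb => [[]].
have cr : c != root by apply: contra cnS => /eqP ->.
have pcS : par c \in S.
  apply/negPn/negP => nS; have := cmin (par c).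
  by rewrite /= inE nS clS' // (dep_par rT cr) ltnn => /(_ isT).
have cTp := subsetP sS' _ cS'.
have mono S1 phi1 p1 (F1 : {set T}) : {in S, phi1 =1 phi} -> {in used S phi, p1 =1 p} ->
    used S phi \subset used S1 phi1 -> uncovered S1 phi1 \subset uncovered S phi ->
    F1 \subset S ->
    (forall g, g \in F1 -> ~ linkable e D m (used S phi) p (uncovered S phi) (phi g) k) ->
    forall g, g \in F1 ->
      ~ linkable e D m (used S1 phi1) p1 (uncovered S1 phi1) (phi1 g) k.
  move=> ephi ep su sq sF1 nl g gF lk; apply: (nl g gF).
  rewrite -(ephi g); last exact: (subsetP sF1).
  exact: linkable_mono su ep sq lk.
have cSN : #|S' :\: (c |: S)| <= N.
  rewrite -ltnS; apply: leq_trans cN; apply/proper_card/properP; split.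
    by apply: setDS; exact: subsetUr.
  by exists c => //; rewrite !inE eqxx.
have sS1 : c |: S \subset S' by rewrite subUset sub1set cS'.
have [|none] := boolP [exists z in Z, c \in traject par z k.*2.+1]; last first.
  have [phi1 [p1 [emb1 ephi ep su sq]]] := embed_vertex emb cTp cnS pcS cr.
  have [z t zZ tz||||phi' [p' [F' [h1 h2 h3 h4 h5]]]] :=
      IH (c |: S) phi1 p1 Z F cSN emb1 sS1 sZ dZ.
  - have := ZS z t zZ tz; rewrite !inE negb_or => /andP[-> ->]; rewrite !andbT.
    by apply: contraNneq none => <-; apply/exists_inP; exists z.
  - exact: subset_trans sF (subsetUr _ _).
  - exact: mono Fnl.
  - exact: ZF.
  have := subset_leq_card sq; exists phi', p', F'; split=> //.
    by apply: leq_trans h4 _; rewrite leq_add2l.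
  exact: leq_trans h5 _.
case/exists_inP=> z zZ; case/trajectP=> i il cE.
(* The path of [z] is still entirely outside [S] while [par c] is inside, so [c] is its topmost
   vertex. *)
have iE : i = k.*2.
  apply/eqP; rewrite eqn_leq -ltnS il /= leqNgt; apply/negP => lt.
  suff : par c \in S' :\: S by rewrite in_setD pcS.
  by apply: (ZS z) => //; apply/trajectP; exists i.+1; rewrite ?cE.
subst i; set g := par c in pcS.
have gE : iter k.*2.+1 par z = g by rewrite /g cE.
have dZ' := trdisjP _ _ _ dZ.
have sub1 t z' : t \in traject par z' k.*2.+1 -> t \in traject par z' k.*2.+2.
  by rewrite [X in _ -> _ \in X]trajectSr mem_rcons in_cons => ->; rewrite orbT.
have sZ1 : Z :\ z \subset Y by exact: subset_trans (subsetDl _ _) sZ.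
have dZ1 : trdisj par k.*2.+2 (Z :\ z).
  apply/trdisjP => z1 z2 t; rewrite !in_setD1 => /andP[_ h1] /andP[_ h2].
  exact: dZ'.
have cZ := cardsD1 z Z; rewrite zZ in cZ.
have [lk|nlk] := boolp.EM
    (linkable e D m (used S phi) p (uncovered S phi) (phi g) k).
  pose cs := rev (traject par z k.*2.+1).
  have [tE lE] : traject par z k.*2.+1 = belast z (traject par (par z) k.*2.+1) /\
                 g = last z (traject par (par z) k.*2.+1).
    have /rcons_inj E : rcons (traject par z k.*2.+1) g =
        rcons (belast z (traject par (par z) k.*2.+1))
              (last z (traject par (par z) k.*2.+1)).
      by rewrite -lastI -trajectS -gE -trajectSr.
    by split; [exact: (congr1 fst E) | exact: (congr1 snd E)].
  have pcs : path (fun a c => par c == a) g cs.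
    by rewrite /cs tE lE rev_path; exact: fpath_traject.
  have szcs : size cs = k.*2.+1 by rewrite size_rev size_traject.
  have csS t : t \in cs -> t \in S' :\: S by rewrite mem_rev; exact: ZS.
  have ucs : uniq cs.
    (* Depth drops by one at each step of the path, which avoids the root because the root is in
       [S]. *)
    have depi j : j < k.*2.+1 -> dep (iter j par z) + j = dep z.
      elim: j => [|j IHj] lt; first by rewrite addn0.
      have ne : iter j par z != root.
        apply/eqP => E; suff : iter j par z \in S' :\: S by rewrite E in_setD rS.
        by apply: (ZS z) => //; apply/trajectP; exists j => //; exact: ltnW.
      by rewrite -(IHj (ltnW lt)) (dep_par rT ne) addnS addSn.
    rewrite rev_uniq; apply/(uniqP z) => i j; rewrite !inE size_traject => li lj.
    rewrite !nth_traject // => E; apply/eqP; rewrite -(eqn_add2l (dep (iter i par z))).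
    by rewrite depi // E depi.
  have lcs : last g cs = z by rewrite /cs trajectS rev_cons last_rcons.
  have csT c1 : c1 \in cs -> c1 \in Tp :\: S.
    by move=> /csS; rewrite !inE => /andP[-> /(subsetP sS')].
  have [phi1 [p1 [emb1 ephi ep su [lq sq]]]] :=
    embed_path emb pcS pcs ucs lcs (subsetP sZ _ zZ) szcs csT lk.
  have cs1 : #|S' :\: (S :|: [set c1 in cs])| <= N.
    apply: leq_trans cSN; apply/subset_leq_card/setDS.
    rewrite subUset sub1set subsetUl andbT in_setU inE mem_rev.
    by apply/orP; right; apply/trajectP; exists k.*2.
  have [|||z' t||||phi' [p' [F' [h1 h2 h3 h4 h5]]]] :=
      IH (S :|: [set c1 in cs]) phi1 p1 (Z :\ z) F cs1 emb1.
  - rewrite subUset sS; apply/subsetP => c1; rewrite inE => /csS.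
    by rewrite inE => /andP[].
  - exact: sZ1.
  - exact: dZ1.
  - rewrite in_setD1 => /andP[ne z'Z] tz'; have := ZS z' t z'Z tz'.
    rewrite in_setD => /andP[tS tS'].
    rewrite in_setD tS' andbT in_setU negb_or tS inE mem_rev /=.
    apply: contra ne => tz; apply/eqP.
    exact: (dZ' z' z t z'Z zZ (sub1 _ _ tz') (sub1 _ _ tz)).
  - exact: subset_trans sF (subsetUl _ _).
  - exact: mono Fnl.
  - by move=> z'; rewrite in_setD1 => /andP[_ /ZF].
  exists phi', p', F'; split=> //; last exact: leq_trans h5 (ltnW lq).
  by move: h4 lq; rewrite cZ; clear; lia.
(* After a failure [g] joins [F] and [z] leaves [Z]; the path of [z] is no longer treated
   specially. *)
have [phi1 [p1 [emb1 ephi ep su sq]]] := embed_vertex emb cTp cnS pcS cr.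
have gF : g \notin F by rewrite -gE; exact: ZF.
have [|||z' t||||phi' [p' [F' [h1 h2 h3 h4 h5]]]] :=
    IH (c |: S) phi1 p1 (Z :\ z) (g |: F) cSN emb1.
- exact: sS1.
- exact: sZ1.
- exact: dZ1.
- rewrite in_setD1 => /andP[ne z'Z] tz'; have := ZS z' t z'Z tz'.
  rewrite in_setD => /andP[tS tS'].
  rewrite in_setD tS' andbT in_setU1 negb_or tS andbT.
  apply: contra ne => /eqP tc; apply/eqP; apply: (dZ' z' z t z'Z zZ (sub1 _ _ tz')).
  by apply: sub1; rewrite tc; apply/trajectP; exists k.*2.
- by rewrite subUset sub1set in_setU1 pcS orbT (subset_trans sF (subsetUr _ _)).
- apply: mono => //; first by rewrite subUset sub1set pcS.
  by move=> g1; rewrite in_setU1 => /orP[/eqP ->|/Fnl].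
(* Trajectories of [k.*2.+2] vertices include the starting points, so disjointness makes these
   distinct. *)
- move=> z'; rewrite in_setD1 => /andP[ne z'Z]; rewrite in_setU1 negb_or ZF // andbT.
  apply: contra ne => /eqP E; apply/eqP.
  apply: (dZ' z' z g z'Z zZ); apply/trajectP; exists k.*2.+1 => //.
exists phi', p', F'; have := subset_leq_card sq; split=> //; last exact: leq_trans h5 _.
by move: h4 (subset_leq_card sq); rewrite cZ cardsU1 gF; clear; lia.
Qed.

(** If more than [m / b ^ k] vertices stayed uncovered, the charging would give at least as many
    failures, and [link] would join a failed starting point to an uncovered vertex. *)
Lemma embed_block k S S' phi p (Z : {set T}) :
  S' \subset Tp -> (forall c, c \in S' -> par c \in S') ->
  embeds S phi p -> S \subset S' -> Z \subset Y -> trdisj par k.*2.+2 Z ->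
  (forall z t, z \in Z -> t \in traject par z k.*2.+1 -> t \in S' :\: S) ->
  b ^ k <= b * m -> #|uncovered S phi| <= #|Z| ->
  exists phi' p', embeds S' phi' p' /\ #|uncovered S' phi'| * b ^ k <= m.
Proof.
move=> sS' clS' emb sS sZ dZ ZS bkm rZ.
have [|||phi' [p' [F [emb' sF nl le _]]]] :=
    @embed_phase k S' #|S' :\: S| S phi p Z set0 sS' clS' (leqnn _) emb sS sZ dZ ZS.
- exact: sub0set.
- by move=> g; rewrite in_set0.
- by move=> z; rewrite in_set0.
exists phi', p'; split=> //; rewrite leqNgt; apply/negP => mU.
have ext' : ext e setT D m (used S' phi') p' by case: emb' => _ _ _ _ [].
have inj' : {in S' &, injective phi'} by case: emb' => _ [].
have mF : m < #|phi' @: F| * b ^ k.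
  rewrite card_in_imset; last by apply: sub_in2 inj'; exact: (subsetP sF).
  apply: leq_trans mU _; rewrite leq_mul2r; apply/orP; right.
  by move: le rZ; rewrite cards0; clear; lia.
have [||||x /imsetP[g gF ->] lk] := @link V e D m cap b e_sym m_gt0 b_gt1 joinedJ cap_le
    k (used S' phi') p' (phi' @: F) (uncovered S' phi') ext' _ _ _ _ bkm mF mU (card_used emb').
- by apply: subset_trans (subsetUl _ _); exact: imsetS.
- by apply: subset_trans (subsetUr _ _); exact: subsetDl.
- rewrite disjoint_sym disjoints_subset; apply/subsetP => v; rewrite in_setD in_setC.
  by case/andP=> h _; apply: contra h; exact: (subsetP (imsetS _ sF)).
- move=> v; apply: leq_trans D_ge; rewrite leq_add2r; exact: outdeg_used emb'.
exact: nl gF lk.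
Qed.

Lemma embed_rest S phi p : embeds S phi p -> Q \subset phi @: S ->
  exists phi' p', embeds Tp phi' p' /\ Q \subset phi' @: Tp.
Proof.
move=> emb QS; have sS : S \subset Tp by case: emb => [[]].
have [|||||| phi' [p' [F [emb' _ _ _ le]]]] :=
    @embed_phase 0 Tp #|Tp :\: S| S phi p set0 set0 (subxx _) Tp_par (leqnn _) emb sS.
- exact: sub0set.
- by apply/trdisjP => z z' t; rewrite in_set0.
- by move=> z t; rewrite in_set0.
- exact: sub0set.
- by move=> g; rewrite in_set0.
- by move=> z; rewrite in_set0.
exists phi', p'; split=> //; rewrite -setD_eq0 -cards_eq0 -leqn0.
by apply: leq_trans le _; rewrite leqn0 cards_eq0 setD_eq0.
Qed.

(** Before block [k] all but the strict descendants of [v] is embedded, at most [b * m / b ^ k]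
    vertices of [Q] are uncovered and at least [kap * m / (4 * Delta) ^ k] elements of [Y] lie at or
    below [v]. The fuel [f] bounds the number of blocks to come. *)
Lemma embed_cover kap f k v phi p :
  8 * Delta ^ 3 <= b -> 6 * b * Delta ^ 2 < kap ->
  b * m <= f + k -> embeds (Tp :\: sdesc par v) phi p ->
  #|uncovered (Tp :\: sdesc par v) phi| * b ^ k <= b * m ->
  kap * m <= weight par Y v * (4 * Delta) ^ k ->
  exists phi' p', embeds Tp phi' p' /\ Q \subset phi' @: Tp.
Proof.
move=> b_ge kap_gt; elim: f k v phi p => [|f IH] k v phi p fk emb rk wk.
  (* Without fuel [k >= b * m], so [b ^ k > b * m] and nothing is uncovered. *)
  apply: embed_rest emb _; rewrite -setD_eq0 -cards_eq0 -leqn0 leqNgt.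
  apply/negP => r0; have := leq_trans (leq_pmull (b ^ k) r0) rk.
  by rewrite leqNgt (leq_ltn_trans fk) // add0n ltn_expl.
set S := Tp :\: sdesc par v in emb rk.
have [r0|r0] := posnP #|uncovered S phi|.
  by apply: embed_rest emb _; rewrite -setD_eq0 -cards_eq0; apply/eqP.
have bkm : b ^ k <= b * m := leq_trans (leq_pmull (b ^ k) r0) rk.
have D0 : 0 < Delta by exact: ltnW.
have b0 : 0 < b by exact: ltnW.
have bk0 : 0 < b ^ k by rewrite expn_gt0 b0.
(* Because [4 * Delta <= b] the powers cancel, and [b] times the weight is at least
   [kap > 6 * b * Delta ^ 2]. *)
have w2 : 2 < weight par Y v.
  have D4 : (4 * Delta) ^ k <= b ^ k.
    have [->//|k0] := posnP k; rewrite leq_exp2r //; apply: leq_trans b_ge.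
    by apply: leq_mul => //; rewrite -[X in X <= _]expn1 leq_exp2l.
  have : kap * b ^ k <= b * weight par Y v * b ^ k.
    apply: leq_trans (leq_mul (leqnn kap) bkm) _; rewrite mulnCA -mulnA.
    rewrite leq_mul2l; apply/orP; right; apply: leq_trans wk _.
    by rewrite leq_mul2l D4 orbT.
  rewrite leq_pmul2r // => /(leq_trans kap_gt).
  rewrite mulnAC mulnC ltn_pmul2l // => /(leq_ltn_trans _); apply.
  by rewrite -[2]/(2 * 1) leq_mul // expn_gt0 D0.
have [v' [v'v ww1 ww2]] := split_weight rT deg_le Delta_gt1 w2.
pose S' := Tp :\: sdesc par v'.
have sS' : S' \subset Tp by exact: subsetDl.
have clS' c : c \in S' -> par c \in S'.
  case/setDP=> cT cn; apply/setDP; split; first exact: Tp_par.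
  by apply: contra cn; exact: (sdesc_par rT).
have sSS : S \subset S' by apply: setDS; exact: (sdesc_sub rT).
(* Dropping the vertices near [v] and those strictly below [v'] keeps the paths of [k.*2.+1]
   vertices inside the block [S' :\: S]. *)
pose Y' := (Y :&: desc par v) :\: (near par v k.*2.+1 :|: sdesc par v').
have [Z [sZ dZ] cZ] := select_disjoint rT deg_le Delta_gt1 k.*2.+1 Y'.
have sZY : Z \subset Y.
  by apply: subset_trans sZ _; apply: subset_trans (subsetDl _ _) (subsetIl _ _).
have ZS z t : z \in Z -> t \in traject par z k.*2.+1 -> t \in S' :\: S.
  move=> zZ tz; have /setDP[/setIP[zY zv]] := subsetP sZ _ zZ.
  rewrite in_setU negb_or => /andP[zn zs'].
  have tTp : t \in Tp.
    case/trajectP: tz => i _ ->; elim: i => [|i IHi] /=; first exact: (subsetP Y_Tp).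
    exact: Tp_par.
  have ts' : t \notin sdesc par v'.
    by apply: contra zs'; exact: (sdesc_traject rT tz).
  have ts : t \in sdesc par v.
    have tv : t != v by apply: contra zn => /eqP <-; rewrite inE.
    rewrite in_setD1 tv inE /=.
    case/trajectP: tz => i il tE; move: zv; rewrite inE => /iter_findex zE.
    have [le|gt] := leqP (findex par z v) i.
      case/negP: zn; rewrite inE; apply/trajectP; exists (findex par z v) => //.
      exact: leq_ltn_trans le il.
    rewrite tE -zE -(subnK (ltnW gt)) iterD; exact: fconnect_iter.
  apply/setDP; split; first by apply/setDP.
  by apply/negP => /setDP[_]; rewrite ts.
have rZ : #|uncovered S phi| <= #|Z|.
  apply: (@block_count Delta b m kap k (weight par Y v) (weight par Y v') #|Y'|
            #|uncovered S phi| #|Z| Delta_gt1 m_gt0 b_ge kap_gt wk rk bkm ww2 _ cZ).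
  have := cardsID (near par v k.*2.+1 :|: sdesc par v') (Y :&: desc par v).
  rewrite -/Y' -/(weight par Y v) => <-; rewrite leq_add2r.
  rewrite setIUr; apply: leq_trans (leq_card_setU _ _) _; rewrite addnC leq_add //.
    apply/subset_leq_card/subsetP => x.
    by case/setIP=> /setIP[xY _] /setD1P[_ xv']; apply/setIP.
  apply: leq_trans (subset_leq_card (subsetIr _ _)) _.
  exact: ltnW (card_near rT deg_le Delta_gt1 _ _).
have [phi' [p' [emb' r']]] := embed_block sS' clS' emb sSS sZY dZ ZS bkm rZ.
apply: (IH k.+1 v' phi' p') => //.
- by rewrite addnS -addSn.
- by rewrite expnS mulnCA leq_mul2l r' orbT.
- apply: leq_trans wk _; rewrite expnS mulnA [_ * (4 * Delta)]mulnC.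
  by rewrite leq_mul2r ww1 orbT.
Qed.

Lemma embed_all kap : 8 * Delta ^ 3 <= b -> 6 * b * Delta ^ 2 < kap ->
  #|Q| <= b * m -> kap * m <= #|Y| ->
  exists phi' p', embeds Tp phi' p' /\ Q \subset phi' @: Tp.
Proof.
move=> b_ge kap_gt Qbm kY.
have SE : Tp :\: sdesc par root = [set root].
  by rewrite setDE (sdesc_root rT); apply/setIidPr; rewrite sub1set.
apply: (@embed_cover kap (b * m) 0 root (fun=> w0) p0) => //.
- by rewrite addn0.
- rewrite SE; split.
  + split; rewrite ?set11 ?sub1set //.
    by move=> c /set1P ->; rewrite (par_root rT) set11.
  + by split=> // x y /set1P -> /set1P ->.
  + by move=> c /set1P -> /eqP.
  + by move=> c _ h; case/negP: (w0Q); exact: h.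
  + split=> //; first by move=> c _; rewrite setU11.
    by rewrite /used imset_set1.
- rewrite expn0 muln1; apply: leq_trans Qbm; exact: subset_leq_card (subsetDl _ _).
- rewrite expn0 muln1; apply: leq_trans kY _; apply/subset_leq_card.
  by rewrite subsetI subxx; apply/subsetP => x _; rewrite inE (fconnect_root rT).
Qed.

End Embedding.

(** * Completing the embedding by a matching *)

Section LeafParents.
Variables (T : sgraph) (root : T) (par : T -> T) (dep : T -> nat) (Delta : nat).
Hypothesis rT : rooting root par dep.
Hypothesis deg_le : forall x : T, deg x <= Delta.

Definition leaf_child y l := [&& l != root, deg l == 1 & par l == y].
Definition leaf_parents := [set y | [exists l, leaf_child y l]].
Definition leaf_of y := odflt y [pick l | leaf_child y l].

Lemma leaf_ofP y : y \in leaf_parents -> leaf_child y (leaf_of y).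
Proof.
rewrite inE => /existsP[l hl]; rewrite /leaf_of; case: pickP => // /(_ l).
by rewrite hl.
Qed.

Lemma par_leaf_of y : y \in leaf_parents -> par (leaf_of y) = y.
Proof. by case/leaf_ofP/and3P=> _ _ /eqP. Qed.

(** The only neighbour of [l] is its parent; a child would coincide with it, against the depths. *)
Lemma leaf_no_child l c : l != root -> deg l = 1 -> par c <> l.
Proof.
move=> lr dl pc; have cr : c != root.
  by apply: contraNneq lr => cE; rewrite -pc cE (par_root rT).
have [a aE] : exists a, [set y | adj l y] = [set a].
  by apply/cards1P; rewrite -/(deg l) dl.
have inA y : adj l y -> y = a by move=> ly; apply/set1P; rewrite -aE inE.
have E : c = par l.
  rewrite (inA (par l) (par_adj rT lr)); apply: inA.
  by rewrite -pc adj_sym (par_adj rT cr).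
have := dep_par rT lr; have := dep_par rT cr; rewrite pc -E; clear; lia.
Qed.

Lemma card_leaves_le : #|leaves T| <= (Delta * #|leaf_parents|).+1.
Proof.
have sub : leaves T \subset root |: \bigcup_(y in leaf_parents) children root par y.
  apply/subsetP => l; rewrite inE => dl; rewrite in_setU1.
  have [//|lr] := eqVneq l root; apply/bigcupP; exists (par l).
    by rewrite inE; apply/existsP; exists l; rewrite /leaf_child lr dl eqxx.
  by rewrite inE lr eqxx.
apply: leq_trans (subset_leq_card sub) _.
apply: leq_trans (leq_card_setU _ _) _; rewrite cards1 add1n ltnS mulnC.
by apply: card_bigcup_le => y _; exact: (card_children rT deg_le).
Qed.

End LeafParents.

Lemma copy_of_matching (G T : sgraph) (root : T) (par : T -> T) (dep : T -> nat)
    (Tp : {set T}) (phi : T -> G) (h : G -> G) :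
  rooting root par dep -> #|T| = #|G| ->
  ~: Tp = leaf_of root par @: leaf_parents root par ->
  (forall c, c \in Tp -> par c \in Tp) -> leaf_parents root par \subset Tp ->
  {in Tp &, injective phi} ->
  (forall c, c \in Tp -> c != root -> adj (phi (par c)) (phi c)) ->
  {in ~: (phi @: Tp) &, injective h} ->
  (forall u, u \notin phi @: Tp ->
     adj u (h u) && (h u \in phi @: leaf_parents root par)) ->
  contains_copy G T.
Proof.
move=> rT cTG TpC clTp sY inj ed injh hP.
set Y := leaf_parents root par in TpC sY hP; set U := ~: (phi @: Tp).
have cU : #|U| = #|Y|.
  have -> : #|Y| = #|~: Tp|.
    rewrite TpC card_in_imset // => x y xY yY E.
    by rewrite -(par_leaf_of xY) -(par_leaf_of yY) E.
  have := cardsC Tp; have := cardsC (phi @: Tp); rewrite -/U card_in_imset //.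
  by rewrite cTG; clear; lia.
have hU : h @: U = phi @: Y.
  apply/eqP; rewrite eqEcard; apply/andP; split.
    apply/subsetP => _ /imsetP[u uU ->]; have := hP u.
    by rewrite -in_setC => /(_ uU)/andP[].
  rewrite (card_in_imset injh) cU; exact: leq_imset_card.
have exg y : y \in Y -> exists u, (u \in U) && (h u == phi y).
  move=> yY; have : phi y \in h @: U by rewrite hU imset_f.
  by case/imsetP=> u uU ->; exists u; rewrite uU eqxx.
pose g y := odflt (phi y) [pick u | (u \in U) && (h u == phi y)].
have gP y : y \in Y -> g y \in U /\ h (g y) = phi y.
  move=> /exg[u hu]; rewrite /g; case: pickP => [u' /andP[? /eqP ?]|/(_ u)] //.
  by rewrite hu.
have notTp x : x \notin Tp -> exists2 y, y \in Y & x = leaf_of root par y.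
  by rewrite -in_setC TpC => /imsetP[y yY ->]; exists y.
have parY x : x \notin Tp -> par x \in Y by case/notTp=> y yY ->; rewrite par_leaf_of.
pose f x := if x \in Tp then phi x else g (par x).
have fU x : x \notin Tp -> f x \in U.
  by move=> xT; rewrite /f (negbTE xT); have [] := gP _ (parY _ xT).
have fT x : x \in Tp -> f x \notin U.
  by move=> xT; rewrite /f xT inE negbK imset_f.
exists f; split.
  move=> x y; have [xT|xT] := boolP (x \in Tp); have [yT|yT] := boolP (y \in Tp).
  - by rewrite /f xT yT; exact: inj.
  - by move=> E; have := fT _ xT; rewrite E fU.
  - by move=> E; have := fT _ yT; rewrite -E fU.
  - rewrite /f (negbTE xT) (negbTE yT) => E.
    have pE : par x = par y.
      apply: inj; rewrite ?(subsetP sY) ?parY //.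
      by have [_ <-] := gP _ (parY _ xT); have [_ <-] := gP _ (parY _ yT); rewrite E.
    move: pE; have [x1 x1Y ->] := notTp _ xT; have [y1 y1Y ->] := notTp _ yT.
    by rewrite !par_leaf_of // => ->.
have edge x : x != root -> adj (f (par x)) (f x).
  move=> xr; have [xT|xT] := boolP (x \in Tp).
    by rewrite /f xT clTp //; exact: ed.
  have pY := parY _ xT; have [gU gE] := gP _ pY.
  rewrite /f (negbTE xT) (subsetP sY) // -gE adj_sym.
  by have := hP (g (par x)); rewrite -in_setC => /(_ gU)/andP[].
move=> x y /(adj_par rT) /orP[/andP[xr /eqP <-]|/andP[yr /eqP <-]].
  by rewrite adj_sym edge.
exact: edge.
Qed.

(** [D] adds the [b] children needed by the forests to the out-degree bound [Delta + 3]. In [kap]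
    the first term serves [block_count], and the others make [cap] fit into the graph. *)
Lemma spanning_tree_copy (G T : sgraph) (Delta m b D kap : nat) :
  1 < Delta -> 0 < m -> b = 8 * Delta ^ 3 -> D = Delta + 3 + b ->
  kap = 6 * b * Delta ^ 2 + 4 * b + 2 * D + 9 ->
  (forall X : {set G}, m <= #|X| -> #|~: nbr (@adj G) X| < m) ->
  (forall X : {set G}, #|X| <= m.*2 -> D * #|X| <= #|nbr (@adj G) X|) ->
  #|T| = #|G| -> is_tree T -> (forall x : T, deg x <= Delta) ->
  Delta * (kap * m) < #|leaves T| -> contains_copy G T.
Proof.
move=> D1 m0 bE DE kE J E cTG treeT degT lvs.
have [root [par [dep rT]]] := tree_rooting treeT.
pose Y := leaf_parents root par; pose Tp := ~: (leaf_of root par @: Y).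
have D0 : 0 < Delta by exact: ltnW.
have b8 : 8 <= b by rewrite bE leq_pmulr // expn_gt0 D0.
have kY : kap * m <= #|Y|.
  rewrite -(leq_pmul2l D0) -ltnS; apply: leq_trans lvs _.
  exact: (card_leaves_le rT degT).
have inL x : x \notin Tp -> exists2 y, y \in Y & x = leaf_of root par y.
  by rewrite in_setC negbK => /imsetP[y yY ->]; exists y.
have noch x c : x \notin Tp -> par c <> x.
  move=> /inL[y yY ->]; have /and3P[lr /eqP dl _] := leaf_ofP yY.
  exact: (leaf_no_child rT).
have Tp_par c : c \in Tp -> par c \in Tp.
  by move=> _; apply/negPn/negP => /noch; apply.
have Tp_root : root \in Tp by rewrite -(par_root rT); apply/negPn/negP => /noch; apply.
have sYT : Y \subset Tp.
  apply/subsetP => y yY; apply/negPn/negP => /noch; apply.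
  exact: par_leaf_of yY.
have injl : {in Y &, injective (leaf_of root par)}.
  by move=> x y xY yY lE; rewrite -(par_leaf_of xY) -(par_leaf_of yY) lE.
have cTp : #|Tp| + #|Y| = #|G|.
  have := cardsC (leaf_of root par @: Y); rewrite -/Tp card_in_imset //.
  by rewrite cTG addnC.
(* Room for the tree, the reservoir and the two forests of [link]; the deleted leaves provide the
   slack demanded by [capV]. *)
pose cap := #|Tp| + 4 * m + 4 * (b.+1 * m).
have capV : cap + m + m.*2 * D <= #|G|.
  have le : (4 * b + 2 * D + 9) * m <= kap * m.
    by rewrite leq_mul2r kE; apply/orP; right; clear; lia.
  have eq : 4 * m + 4 * (b.+1 * m) + m + m.*2 * D = (4 * b + 2 * D + 9) * m.
    by rewrite -mul2n; clear; lia.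
  by move: eq (leq_trans le kY) cTp; rewrite /cap; clear; lia.
have [||Q [w0 [p0 [w0Q extQ cQ odQ QY]]]] :=
    @reservoir G (@adj G) D m cap m0 _ J E capV _.
- by rewrite DE; move: D1; clear; lia.
- by rewrite /cap; clear; lia.
have capT : #|Tp| + #|Q| + 4 * (b.+1 * m) <= cap by rewrite /cap leq_add2r leq_add2l.
have DE' : Delta + 3 + b <= D by rewrite DE.
have b1 : 1 < b by move: b8; clear; lia.
have [||||phi [p [emb sQ]]] := @embed_all T root par dep Delta rT degT D1 G (@adj G) D m cap b
    (@adj_sym G) m0 b1 DE' J capV Q w0 p0 w0Q extQ odQ Tp Y Tp_root Tp_par sYT capT kap.
- by rewrite bE.
- by rewrite kE; clear; lia.
- by apply: leq_trans cQ _; rewrite leq_mul2r; move: b8; clear; lia.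
- exact: kY.
have od v := outdeg_used degT odQ v emb.
case: emb => [[_ _ _] [inj _] ed QinY [_ _ ext']].
have usedE : used Q Tp phi = phi @: Tp by apply/setUidPl.
rewrite usedE in ext' od.
set U := ~: (phi @: Tp); set P := phi @: Y.
have cP : #|P| = #|Y|.
  by apply: card_in_imset; apply: sub_in2 inj; exact: (subsetP sYT).
have cU : #|U| = #|Y|.
  have := cardsC (phi @: Tp); rewrite -/U card_in_imset // -cTp; clear; lia.
have QP : Q \subset P.
  apply/subsetP => q qQ; have /imsetP[c cT qE] := subsetP sQ _ qQ.
  by rewrite qE imset_f // QinY // -qE.
pose e' := [rel u w : G | adj u w && (w \in P)].
have nbrE X : nbr e' X = nbr (@adj G) X :&: P.
  apply/setP => w; rewrite in_setI; apply/nbrP/andP.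
    by case=> x xX /andP[axw wP]; split=> //; apply/nbrP; exists x.
  by case=> /nbrP[x xX axw] wP; exists x; rewrite //= axw.
have [|h [injh hP]] := @hall G e' U.
  (* Up to size [m] the reservoir [Q], which is part of [P], suffices. *)
  move=> X sX; rewrite nbrE; have [Xm|Xm] := leqP #|X| m.
    by apply: leq_trans (QY X Xm) _; apply/subset_leq_card/setIS.
  rewrite leqNgt; apply/negP => lt.
  (* [X'] has fewer than [m] elements and no edge to [X], so its free neighbours lie in [U :\: X].
     Expansion gives [b * #|X'| <= #|U| - #|X|], which contradicts [lt] since [U] and [P] have equal
     size. *)
  pose X' := P :\: nbr (@adj G) X.
  have cX' : #|X'| + #|nbr (@adj G) X :&: P| = #|P|.
    by rewrite -(cardsID (nbr (@adj G) X) P) setIC addnC.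
  have X'm : #|X'| < m.
    apply: leq_ltn_trans (J X (ltnW Xm)); apply/subset_leq_card/subsetP => v.
    by rewrite in_setD in_setC => /andP[].
  have [_ h2] := extP _ _ _ _ _ _ ext'.
  have m2 : #|X'| <= m.*2 by move: X'm; clear; lia.
  have := leq_trans (h2 X' (subsetT _) m2) (rnbr_outdeg _ (fun x _ => od x)).
  have : nbr (@adj G) X' :\: phi @: Tp \subset U :\: X.
    apply/subsetP => v /setDP[/nbrP[x xX' axv] vT]; apply/setDP.
    split; first by rewrite in_setC.
    apply/negP => vX; case/setDP: xX' => _ /negP; apply.
    by apply/nbrP; exists v; rewrite // adj_sym.
  move/subset_leq_card; rewrite (cardsDS sX).
  rewrite DE mulnDl.
  have : #|X'| <= b * #|X'| by rewrite leq_pmull // ltnW.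
  move: lt cX' cP cU (subset_leq_card sX); clear; lia.
apply: (copy_of_matching rT cTG (Tp := Tp) (phi := phi) (h := h)) => //.
- by rewrite /Tp setCK.
- by move=> u uT; have := hP u; rewrite in_setC => /(_ uT).
Qed.

(** * Pseudorandomness from the spectral gap *)

Import Order.TTheory GRing.Theory Num.Theory.

Section SpectralGap.
Local Open Scope ring_scope.
Local Open Scope sesquilinear_scope.

Definition sqnorm (C : numClosedFieldType) n (v : 'rV[C]_n) : C :=
  (v *m v ^t*) 0 0.

Lemma sqnormE (C : numClosedFieldType) n (v : 'rV[C]_n) :
  sqnorm v = \sum_i `|v 0 i| ^+ 2.
Proof.
rewrite /sqnorm mxE; apply: eq_bigr => i _.
by rewrite !mxE normCK.
Qed.

(** In the eigenbasis formed by the rows of [P], [u] lies along the [i0]-th vector. That component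
    of [g] is scaled by [d], all others by at most [lam]. The factor [sqnorm u] avoids normalising
    [u]. *)
Lemma gap_sqnorm_mul (C : numClosedFieldType) n (B P : 'M[C]_n)
    (delta u g : 'rV[C]_n) (lam d : C) (i0 : 'I_n) :
  0 <= lam -> P \is unitarymx -> B = P ^t* *m diag_mx delta *m P ->
  u *m B = d *: u -> delta 0 i0 = d ->
  (forall i, i != i0 -> delta 0 i != d /\ `|delta 0 i| <= lam) ->
  sqnorm (g *m B) * sqnorm u <=
  lam ^+ 2 * sqnorm g * sqnorm u + `|d| ^+ 2 * `|(g *m u ^t*) 0 0| ^+ 2.
Proof.
move=> lam0 PU BE uB d0 gap; have PP := unitarymxP PU.
have PP' : P ^t* *m P = 1%:M by apply: mulmx1C.
have [c gE] : exists c, g = c *m P.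
  by exists (g *m P ^t*); rewrite -mulmxA PP' mulmx1.
have [a uE] : exists a, u = a *m P.
  by exists (u *m P ^t*); rewrite -mulmxA PP' mulmx1.
have dotP (v w : 'rV[C]_n) : (v *m P) *m (w *m P) ^t* = v *m w ^t*.
  by rewrite trmx_mul map_mxM mulmxA -(mulmxA v) PP mulmx1.
have aE i : i != i0 -> a 0 i = 0.
  move=> /gap[ned _].
  have : a *m diag_mx delta = d *: a.
    have : (a *m diag_mx delta) *m P *m P ^t* = (d *: a) *m P *m P ^t*.
      by rewrite -scalemxAl -uE -uB BE uE !mulmxA -(mulmxA a P) PP mulmx1.
    by rewrite -!(mulmxA _ P) PP !mulmx1.
  move/rowP/(_ i); rewrite mul_mx_diag !mxE => /eqP.
  rewrite mulrC -subr_eq0 -mulrBl mulf_eq0 subr_eq0 (negbTE ned) /=.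
  by move/eqP.
have -> : sqnorm g = sqnorm c by rewrite /sqnorm {1 2}gE dotP.
have sqa : sqnorm u = `|a 0 i0| ^+ 2.
  rewrite /sqnorm {1 2}uE dotP -/(sqnorm a) sqnormE (bigD1 i0) //= big1 ?addr0 //.
  by move=> i /aE ->; rewrite normr0 expr0n.
have -> : `|(g *m u ^t*) 0 0| ^+ 2 = `|c 0 i0| ^+ 2 * `|a 0 i0| ^+ 2.
  rewrite gE uE dotP mxE (bigD1 i0) //= big1 ?addr0; last first.
    by move=> i /aE ai; rewrite !mxE ai conjC0 mulr0.
  by rewrite !mxE normrM norm_conjC exprMn.
have -> : sqnorm (g *m B) = \sum_i (`|c 0 i| ^+ 2 * `|delta 0 i| ^+ 2).
  have -> : g *m B = c *m diag_mx delta *m P.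
    by rewrite BE gE !mulmxA -(mulmxA c P) PP mulmx1.
  rewrite /sqnorm dotP.
  rewrite -/(sqnorm _) sqnormE; apply: eq_bigr => i _.
  by rewrite mul_mx_diag mxE normrM exprMn.
rewrite sqa mulrA -mulrDl ler_wpM2r ?exprn_ge0 //.
rewrite sqnormE (bigD1 i0) //= d0 addrC mulrC lerD2r.
rewrite [X in _ <= _ * X](bigD1 i0) //= mulrDr -[X in X <= _]add0r.
apply: lerD; first by rewrite mulr_ge0 ?exprn_ge0.
rewrite mulr_sumr; apply: ler_sum => i /gap[_ le].
by rewrite mulrC ler_wpM2r ?exprn_ge0 // lerXn2r ?nnegrE.
Qed.

Lemma char_poly_diagonalized (C : numClosedFieldType) n (B P : 'M[C]_n)
    (delta : 'rV[C]_n) :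
  P \is unitarymx -> B = P ^t* *m diag_mx delta *m P ->
  char_poly B = \prod_i ('X - (delta 0 i)%:P).
Proof.
move=> PU BE; have PP := mulmx1C (unitarymxP PU).
have PPp : map_mx polyC (P ^t*) *m map_mx polyC P = 1%:M.
  by rewrite -map_mxM PP map_mx1.
transitivity (char_poly (diag_mx delta)); last first.
  rewrite char_poly_trig ?diag_mx_is_trig //.
  by apply: eq_bigr => i _; rewrite mxE eqxx mulr1n.
have -> : char_poly B = \det (map_mx polyC (P ^t*) *m
    char_poly_mx (diag_mx delta) *m map_mx polyC P).
  rewrite /char_poly BE /char_poly_mx mulmxBr mulmxBl !map_mxM /=.
  by rewrite scalar_mxC -(mulmxA 'X%:M) PPp mulmx1.
by rewrite !det_mulmx mulrAC -det_mulmx PPp det1 mul1r.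
Qed.

(** The all-ones vector is an eigenvector for [d]. As [lam < d], the value [d] occurs in [s] only as
    its head, hence is a simple root, and [gap_sqnorm_mul] applies over the complex numbers. *)
Lemma gap_sum_sqr (R : realType) n (A : 'M[R]_n) (s : seq R) (d lam : R)
    (f : 'rV[R]_n) :
  A^T = A -> is_spectrum A s -> (forall mu, mu \in behead s -> `|mu| <= lam) ->
  const_mx 1 *m A = d *: (const_mx 1 : 'rV_n) -> 0 < lam < d -> (0 < n)%N ->
  (\sum_i ((f *m A) 0 i) ^+ 2) * n%:R <=
  lam ^+ 2 * (\sum_i (f 0 i) ^+ 2) * n%:R + d ^+ 2 * (\sum_i f 0 i) ^+ 2.
Proof.
move=> Asym [_ spE] bnd uA /andP[lam0 lamd] n0.
pose toC : {rmorphism R -> R[i]} := real_complex R.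
pose B := map_mx toC A; pose P := spectralmx B; pose delta := spectral_diag B.
have Breal : B \is a realmx.
  by apply/mxOverP => i j; rewrite mxE; apply/complex_realP; exists (A i j).
have Bherm : B \is hermsymmx.
  apply: realsym_hermsym => //; apply/is_hermitianmxP.
  by rewrite expr0 scale1r map_mx_id // /B map_trmx Asym.
have PU : P \is unitarymx := spectral_unitarymx B.
have BE : B = P ^t* *m diag_mx delta *m P.
  have /orthomx_spectralP := hermitian_normalmx Bherm.
  by rewrite invmx_unitary.
have chB := char_poly_diagonalized PU BE.
have chS : char_poly B = \prod_(x <- s) ('X - (toC x)%:P).
  rewrite -map_char_poly spE rmorph_prod /=; apply: eq_bigr => x _.
  by rewrite rmorphB /= map_polyX map_polyC.
pose u : 'rV[R[i]]_n := const_mx 1.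
have uE : u = map_mx toC (const_mx 1) by rewrite map_const_mx rmorph1.
have uB : u *m B = toC d *: u.
  by rewrite uE -map_mxM uA map_mxZ.
have u0 : u != 0.
  apply/eqP => /rowP/(_ (Ordinal n0)); rewrite !mxE => /eqP.
  by rewrite oner_eq0.
have rootS x : root (char_poly B) x = (x \in map toC s).
  by rewrite chS -(big_map toC xpredT (fun y => 'X - y%:P)) root_prod_XsubC.
have rootD i : root (char_poly B) (delta 0 i).
  by rewrite chB -(big_map (delta 0) xpredT (fun y => 'X - y%:P)) root_prod_XsubC;
     apply: map_f; rewrite mem_index_enum.
have rootd : root (char_poly B) (toC d).
  rewrite -eigenvalue_root_char; apply/eigenvalueP.
  by exists u.
have notb x : lam < x -> toC x \notin map toC (behead s).
  move=> lx; rewrite mem_map; last exact: complexI.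
  apply/negP => /bnd; rewrite leNgt; case/negP.
  by apply: lt_le_trans lx (ler_norm _).
have [t st] : exists t, s = d :: t.
  move: rootd (notb _ lamd); rewrite rootS.
  case: (s) => [//|x t] /=; rewrite in_cons => /orP[/eqP/complexI ->|->//].
  by move=> _; exists t.
have [i0 d0] : exists i0, delta 0 i0 = toC d.
  move: rootd; rewrite chB -(big_map (delta 0) xpredT (fun y => 'X - y%:P)).
  by rewrite root_prod_XsubC => /mapP[i _ ->]; exists i.
(* A second occurrence of [d] would, after cancelling one linear factor, make [d] a root of the
   product over the tail [t]. *)
have ned i : i != i0 -> delta 0 i != toC d.
  move=> ii0; apply/eqP => di; have := notb _ lamd; rewrite st /=.
  case/negP; rewrite -root_prod_XsubC big_map.
  have : ('X - (toC d)%:P) * \prod_(x <- t) ('X - (toC x)%:P) =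
         ('X - (toC d)%:P) * \prod_(j | j != i0) ('X - (delta 0 j)%:P).
    have := chS; rewrite chB st big_cons => <-.
    by rewrite (bigD1 i0) //= d0.
  have X0 : 'X - (toC d)%:P != 0 by rewrite polyXsubC_eq0.
  move/(mulfI X0) => ->.
  rewrite (bigD1 i) //= di.
  by rewrite rootM root_XsubC eqxx.
have gap i : i != i0 -> delta 0 i != toC d /\ `|delta 0 i| <= toC lam.
  move=> ii0; split; first exact: ned.
  have := rootD i; rewrite rootS st /= in_cons (negbTE (ned i ii0)) /=.
  case/mapP=> x xt ->; rewrite normc_def /= expr0n addr0 sqrtr_sqr lecR.
  by apply: bnd; rewrite st.
have lamC : 0 <= toC lam by rewrite (lecR 0) ltW.
have := gap_sqnorm_mul (map_mx toC f) lamC PU BE uB d0 gap.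
have sqE (v : 'rV[R]_n) : sqnorm (map_mx toC v) = toC (\sum_i (v 0 i) ^+ 2).
  rewrite sqnormE rmorph_sum; apply: eq_bigr => i _.
  rewrite mxE normc_def /= expr0n addr0 sqrtr_sqr -rmorphXn /=.
  by rewrite real_normK ?num_real.
have -> : (map_mx toC f *m u ^t*) 0 0 = toC (\sum_i f 0 i).
  rewrite mxE rmorph_sum; apply: eq_bigr => i _.
  by rewrite !mxE conjC1 mulr1.
rewrite -map_mxM sqE uE sqE.
have -> : \sum_i ((const_mx 1 : 'rV[R]_n) 0 i) ^+ 2 = n%:R.
  rewrite (eq_bigr (fun=> 1)) => [|i _]; last by rewrite mxE expr1n.
  by rewrite sumr_const card_ord.
have normE (x : R) : `|toC x| ^+ 2 = toC (x ^+ 2).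
  rewrite normc_def /= expr0n addr0 sqrtr_sqr -rmorphXn /=.
  by rewrite real_normK ?num_real.
by rewrite !normE sqE -!rmorphXn -!rmorphM -rmorphD lecR.
Qed.

End SpectralGap.

(** * Neighbourhood expansion from the second moment of degrees *)

Section Pseudorandom.
Local Open Scope ring_scope.

(** Cauchy-Schwarz, from the nonnegative sum of the squares of [#|N| * c i - S]. *)
Lemma sum_sqr_le (R : realFieldType) (I : finType) (N : {set I}) (c : I -> R) :
  (\sum_(i in N) c i) ^+ 2 <= #|N|%:R * \sum_(i in N) c i ^+ 2.
Proof.
set S := \sum_(i in N) c i; set Q := \sum_(i in N) c i ^+ 2.
have [N0|N0] := posnP #|N|.
  by rewrite /S big_pred0 ?expr0n ?N0 ?mul0r // => i; rewrite (cards0_eq N0) in_set0.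
have k0 : 0 < #|N|%:R :> R by rewrite ltr0n.
have : 0 <= \sum_(i in N) (#|N|%:R * c i - S) ^+ 2.
  by apply: sumr_ge0 => i _; exact: sqr_ge0.
rewrite (eq_bigr (fun i => (#|N|%:R ^+ 2 * c i ^+ 2 + (- (2 * #|N|%:R * S)) * c i) + S ^+ 2)); last first.
  by move=> i _; ring.
rewrite !big_split /= -!mulr_sumr -/S -/Q sumr_const -[S *+ #|N|]mulr_natl.
have -> : #|N|%:R ^+ 2 * Q + - (2 * #|N|%:R * S) * S + S * (#|N|%:R * S) =
          #|N|%:R * (#|N|%:R * Q - S ^+ 2) :> R by ring.
by rewrite pmulr_rge0 // subr_ge0.
Qed.

(** This is [gap_sum_sqr] for the indicator vector of [X]. *)
Lemma deg_in_sum_sqr (R : realType) n d (lam : R) (G : sgraph) (X : {set G}) :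
  ndl_graph n d lam G -> 0 < lam < d%:R ->
  (\sum_(v : G) #|[set x in X | adj x v]|%:R ^+ 2) * n%:R <=
  lam ^+ 2 * #|X|%:R * n%:R + d%:R ^+ 2 * #|X|%:R ^+ 2 :> R.
Proof.
move=> [cG reg [s [spE bnd]]] lamd.
have [n0|n0] := posnP n.
  by rewrite n0 !mulr0 add0r mulr_ge0 ?sqr_ge0.
pose f : 'rV[R]_#|G| := \row_i (enum_val i \in X)%:R.
have enumsum (F : G -> R) : \sum_(i < #|G|) F (enum_val i) = \sum_v F v.
  by rewrite -big_enum_val; apply: eq_bigl.
have cardsum (P : pred G) : \sum_(i < #|G|) (P (enum_val i))%:R = #|P|%:R :> R.
  rewrite (enumsum (fun x => (P x)%:R)) -sum1_card natr_sum.
  by rewrite [RHS]big_mkcond /=; apply: eq_bigr => x _; rewrite unfold_in; case: (P x).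
have fA v : (f *m adj_mx R G) 0 v = #|[set x in X | adj x (enum_val v)]|%:R.
  rewrite mxE cardsE -cardsum; apply: eq_bigr => i _.
  by rewrite !mxE -natrM mulnb.
have := @gap_sum_sqr R #|G| (adj_mx R G) s d%:R lam f.
have -> : \sum_i (f *m adj_mx R G) 0 i ^+ 2 =
    \sum_(v : G) #|[set x in X | adj x v]|%:R ^+ 2 :> R.
  rewrite -enumsum; apply: eq_bigr => i _.
  by rewrite fA.
have -> : \sum_i f 0 i = #|X|%:R.
  by rewrite -cardsum; apply: eq_bigr => i _; rewrite mxE.
have -> : \sum_i f 0 i ^+ 2 = #|X|%:R.
  rewrite -(cardsum (fun x => x \in X)); apply: eq_bigr => i _; rewrite mxE /=.
  by case: (enum_val i \in X); rewrite ?expr1n ?expr0n.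
rewrite -cG; apply=> //; last by rewrite cG.
  by apply/matrixP => i j; rewrite !mxE adj_sym.
apply/rowP => j; rewrite !mxE mulr1 -(reg (enum_val j)) /deg cardsE -cardsum.
by apply: eq_bigr => i _; rewrite !mxE mul1r adj_sym.
Qed.

Lemma sum_deg_in n d (R : realType) (lam : R) (G : sgraph) (X : {set G}) :
  ndl_graph n d lam G ->
  (\sum_(v in nbr (@adj G) X) #|[set x in X | adj x v]| = d * #|X|)%N.
Proof.
move=> [_ reg _].
rewrite big_mkcond /= (eq_bigr (fun v => \sum_(x in X) adj x v)%N).
  rewrite exchange_big /= (eq_bigr (fun=> d)); last first.
    move=> x _; rewrite -(reg x) /deg -sum1dep_card [RHS]big_mkcond /=.
    by apply: eq_bigr => v _; case: adj.
  by rewrite sum_nat_const mulnC.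
move=> v _; have cE : (#|[set x in X | adj x v]| = \sum_(x in X) adj x v)%N.
  rewrite -sum1dep_card big_mkcondr /=.
  by apply: eq_bigr => x _; case: adj.
rewrite -cE; case: ifP => // /negbT vN; apply/esym/eqP.
rewrite cards_eq0; apply/eqP/setP => x; rewrite !inE; apply/negbTE/negP.
by case/andP=> xX axv; case/negP: vN; apply/nbrP; exists x.
Qed.

(** Cauchy-Schwarz on [N]: the degrees into [X] sum to [d * #|X|], and [deg_in_sum_sqr] bounds the
    sum of their squares. *)
Lemma nbr_expansion (R : realType) n d (lam : R) (G : sgraph) (X : {set G}) :
  ndl_graph n d lam G -> 0 < lam < d%:R ->
  d%:R ^+ 2 * #|X|%:R * n%:R <=
  #|nbr (@adj G) X|%:R * (lam ^+ 2 * n%:R + d%:R ^+ 2 * #|X|%:R) :> R.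
Proof.
move=> ndl lamd; set N := nbr _ X.
have [x0|x0] := posnP #|X|.
  rewrite x0 !(mulr0, mul0r) addr0 mulr_ge0 // mulr_ge0 ?sqr_ge0 //.
rewrite -(ler_pM2l (_ : 0 < #|X|%:R)) ?ltr0n //.
pose c v : R := #|[set x in X | adj x v]|%:R.
have := sum_sqr_le N c.
have -> : \sum_(v in N) c v = d%:R * #|X|%:R.
  by rewrite -natrM -(sum_deg_in X ndl) natr_sum.
have le : \sum_(v in N) c v ^+ 2 <= \sum_v c v ^+ 2.
  rewrite [X in _ <= X](bigID (mem N)) /= lerDl.
  by apply: sumr_ge0 => v _; exact: sqr_ge0.
have := deg_in_sum_sqr X ndl lamd; rewrite -/c => mom cs.
have : (d%:R * #|X|%:R) ^+ 2 * n%:R <= #|N|%:R * ((\sum_v c v ^+ 2) * n%:R) :> R.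
  rewrite mulrA ler_wpM2r // (le_trans cs) // ler_wpM2l //.
move=> /le_trans h.
have := h _ (ler_wpM2l (ler0n R #|N|) mom).
congr (_ <= _); ring.
Qed.

Lemma pseudorandom_nbr (R : realType) n d (lam : R) (G : sgraph) (D : nat) :
  ndl_graph n d lam G -> (0 < n)%N -> (0 < D)%N -> (5 * D)%:R <= d%:R / lam ->
  exists m : nat,
  [/\ (0 < m)%N, m%:R <= 2 * (lam * n%:R / d%:R),
      forall X : {set G}, (m <= #|X|)%N -> (#|~: nbr (@adj G) X| < m)%N &
      forall X : {set G}, (#|X| <= m.*2)%N -> (D * #|X| <= #|nbr (@adj G) X|)%N].
Proof.
move=> ndl n0 D0 hD.
have D1 : 1 <= D%:R :> R by rewrite ler1n.
have lam0 : 0 < lam.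
  rewrite ltNge; apply/negP => lam0.
  have : d%:R / lam <= 0 by rewrite mulr_ge0_le0 // invr_le0.
  by move: hD; rewrite natrM; lra.
have lamd5 : 5 * D%:R * lam <= d%:R.
  by move: hD; rewrite ler_pdivlMr // natrM.
have lamd : lam < d%:R by nra.
have d0 : 0 < d%:R :> R by lra.
have nR0 : 0 < n%:R :> R by rewrite ltr0n.
have lamd' : 0 < lam < d%:R by rewrite lam0.
have dn : (d < n)%N.
  case: ndl => cG reg _; move: n0; rewrite -cG => /card_gt0P[v _].
  rewrite -(reg v) /deg -[X in (_ < X)%N]cardsT; apply/proper_card/properP.
  by split; [exact: subsetT | exists v; rewrite ?inE ?adj_irr].
(* Expansion of one vertex gives [d * (n - d) <= lam ^ 2 * n], hence [d <= lam ^ 2 * n] as [d < n];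
   multiply by [d <= n]. So [q] is at least 1, and rounding it up to [m] at most doubles it. *)
have base : d%:R <= lam * n%:R.
  have cG : #|G| = n by case: ndl.
  have [v _] : exists v : G, v \in G by apply/card_gt0P; rewrite cG.
  have := nbr_expansion [set v] ndl lamd'; rewrite cards1 !mulr1.
  have -> : nbr (@adj G) [set v] = [set w | adj v w].
    apply/setP => w; rewrite [RHS]inE; apply/nbrP/idP.
      by case=> x /set1P ->.
    by exists v; rewrite ?inE.
  have -> : #|[set w | adj v w]| = d by case: ndl => _ reg _; exact: reg.
  rewrite expr2 -mulrA ler_pM2l // => h.
  have dn1 : d%:R + 1 <= n%:R :> R by rewrite natr1 ler_nat.
  have h2 : d%:R <= lam ^+ 2 * n%:R by nra.
  have h3 : d%:R ^+ 2 <= (lam * n%:R) ^+ 2 by rewrite exprMn expr2 [n%:R ^+ 2]expr2 mulrA; apply: ler_pM => //; lra.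
  rewrite -(@ler_pXn2r R 2) ?nnegrE ?mulr_ge0 //; exact: ltW.
pose q := lam * n%:R / d%:R.
have q1 : 1 <= q by rewrite ler_pdivlMr // mul1r.
have qd : q * d%:R = lam * n%:R by rewrite /q divfK // gt_eqF.
exists (Num.truncn q).+1.
have [tq1 tq2] : (Num.truncn q)%:R <= q /\ q < (Num.truncn q).+1%:R.
  have /andP[] : (Num.truncn q)%:R <= q < (Num.truncn q).+1%:R by apply: truncn_itv; lra.
  by [].
set m := (Num.truncn q).+1 in tq2 *.
have mq : m%:R <= 2 * q by rewrite /m -natr1; lra.
split=> // X hX.
(* Otherwise [x] and [y] both exceed [q], while expansion forces [x * y <= q ^ 2]. *)
- rewrite ltnNge; apply/negP => hY.
  have := nbr_expansion X ndl lamd'.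
  set N := nbr _ X in hY *; set x : R := #|X|%:R; set y : R := #|~: N|%:R.
  have -> : #|N|%:R = n%:R - y :> R.
    have := cardsC N; have -> : #|G| = n by case: ndl.
    by move=> <-; rewrite natrD /y; ring.
  have mx : m%:R <= x by rewrite ler_nat.
  have my : m%:R <= y by rewrite ler_nat.
  have x0 : 0 < x by lra.
  have y0 : 0 < y by lra.
  move=> h.
  have h1 : y * (d%:R ^+ 2 * x) <= lam ^+ 2 * n%:R ^+ 2.
    have : 0 <= y * (lam ^+ 2 * n%:R) by rewrite !mulr_ge0 ?sqr_ge0 ?ltW.
    move: h; rewrite [n%:R ^+ 2]expr2; lra.
  have h2 : q ^+ 2 < x * y.
    by rewrite expr2; apply: ltr_pM => //; lra.
  have : d%:R ^+ 2 * q ^+ 2 < d%:R ^+ 2 * (x * y) by rewrite ltr_pM2l // exprn_gt0.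
  rewrite -exprMn [d%:R * q]mulrC qd exprMn; lra.
- have := nbr_expansion X ndl lamd'.
  set N := nbr _ X; set x : R := #|X|%:R => h.
  have xm : x <= 2 * m%:R by rewrite -natrM ler_nat mul2n.
  have xq : d%:R * x <= 4 * (lam * n%:R) by rewrite -qd; nra.
  (* One [d * lam * n] comes from [lam <= d] and four from [x <= 2 * m <= 4 * q]; hence the 5 in the
     hypothesis. *)
  have bd : lam ^+ 2 * n%:R + d%:R ^+ 2 * x <= d%:R * (5 * lam * n%:R).
    have : lam * (lam * n%:R) <= d%:R * (lam * n%:R).
      by rewrite ler_wpM2r ?mulr_ge0 ?ltW.
    have : d%:R * (d%:R * x) <= d%:R * (4 * (lam * n%:R)) by rewrite ler_pM2l.
    rewrite !expr2; lra.
  have N0 : 0 <= #|N|%:R :> R by [].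
  have h2 := le_trans h (ler_wpM2l N0 bd).
  have h3 : d%:R * x <= #|N|%:R * (5 * lam).
    have dn0 : 0 < d%:R * n%:R :> R by rewrite mulr_gt0.
    rewrite -(ler_pM2l dn0); move: h2; congr (_ <= _); ring.
  rewrite -(ler_nat R) natrM -/x.
  have x0 : 0 <= x by [].
  have h4 : 5 * D%:R * lam * x <= d%:R * x by rewrite ler_wpM2r.
  have l5 : 0 < 5 * lam by lra.
  rewrite -(ler_pM2l l5); lra.
Qed.

End Pseudorandom.

(** * Choice of the constants *)

Local Open Scope ring_scope.

Theorem theorem4p2 (R : realType) (Delta : nat) :
  exists K C : R, [/\ 0 < K, 0 < C &
    exists d0 : nat, forall d : nat, (d0 <= d)%N ->
    forall (n : nat) (lam : R) (G : sgraph),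
      ndl_graph n d lam G ->
      C <= d%:R / lam ->
      forall T : sgraph,
        #|T| = n ->
        is_tree T ->
        (max_deg T <= Delta)%N ->
        K * lam * n%:R / d%:R <= #|leaves T|%:R ->
        contains_copy G T].
Proof.
(* Raising the degree bound to at least 2 provides the [1 < Delta] of the counting estimates. *)
pose dl := maxn Delta 2; pose b := (8 * dl ^ 3)%N; pose D := (dl + 3 + b)%N.
pose kap := (6 * b * dl ^ 2 + 4 * b + 2 * D + 9)%N.
have D0 : (0 < D)%N by rewrite /D addn_gt0 addn_gt0 orbT.
(* As [m] is at most twice [lam * n / d], this [K] yields at least [(dl * kap).+1 * m] leaves,
   strictly more than [dl * kap * m]. *)
exists (2 * (dl * kap).+1)%:R, (5 * D)%:R; split; rewrite ?ltr0n ?muln_gt0 //.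
exists 0%N => d _ n lam G ndl hC T cT treeT mdeg lvs.
have n0 : (0 < n)%N by rewrite -cT; case: treeT => -[].
have [m [m0 mq J E]] := pseudorandom_nbr ndl n0 D0 hC.
have dl1 : (1 < dl)%N by rewrite leq_max orbT.
have cG : #|T| = #|G| by rewrite cT; case: ndl.
have degT (x : T) : (deg x <= dl)%N.
  by apply: leq_trans (leq_bigmax x) (leq_trans mdeg (leq_maxl _ _)).
apply: (spanning_tree_copy dl1 m0 (erefl b) (erefl D) (erefl kap) J E cG treeT degT).
have lvs' : (dl * kap).+1%:R * (2 * (lam * n%:R / d%:R)) <= #|leaves T|%:R :> R.
  by move: lvs; rewrite natrM; congr (_ <= _); ring.
rewrite -(ler_nat R); apply: le_trans lvs'.
apply: le_trans (ler_wpM2l (ler0n R _) mq).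
by rewrite -natrM ler_nat mulSn mulnA -add1n leq_add2r.
Qed.
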